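(* Let $(U,V)$ and $(X,Y)$ be $\mathsf{DSBS}(p)$ and $\mathsf{DSBS}(p+\delta)$ respectively, where $0\le p\le p+\delta\le\frac12$ ($p$ is fixed, while $\delta=\delta_n$ and $\epsilon=\epsilon_n$ may depend on $n$). Suppose that $p_{XY}$ is $(n,\epsilon)$-simulable from $p_{UV}$ via $p_{X^n|U^n}$ and $p_{Y^n|V^n}$. Then there exist a coordinate permutation $\sigma$ and scalar conditional distributions $q_{X_i|U_i}$ and $q_{Y_i|V_i}$, $i\in[n]$ (all allowed to depend on $n$), such that $$D_1:=d_{\mathsf{TV}}\Big(p_{\sigma(X^n)|U^n}(\cdot\mid U^n),\ \prod_{i=1}^n q_{X_i|U_i}(\cdot\mid U_i)\Big)\to 0,$$ $$D_2:=d_{\mathsf{TV}}\Big(p_{\sigma(Y^n)|V^n}(\cdot\mid V^n),\ \prod_{i=1}^n q_{Y_i|V_i}(\cdot\mid V_i)\Big)\to 0$$ in probability as $n\to\infty$, provided that $\epsilon,\delta=o(1/n)$. Conversely, if $\delta=\omega(1/\sqrt n)$ or $\epsilon=\omega(1/\sqrt n)$ then no such guarantee can be made: it is possible for $D_1,D_2$ to be bounded away from zero in probability as $n\to\infty$, for any coordinate permutation and any scalar conditional distributions $q_{X_i|U_i}$ and $q_{Y_i|V_i}$.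
   Context: $\mathsf{DSBS}(p)$ (doubly symmetric binary source) is the distribution of a pair of binary random variables $(U,V)$, each uniform, with $\Pr(U\ne V)=p$. $p^{\otimes n}$ denotes the $n$-fold i.i.d. product; $[n]=\{1,\dots,n\}$. $(n,\epsilon)$-simulability via given kernels: with $(U^n,V^n)\sim p_{UV}^{\otimes n}$, the distribution $p_{XY}$ is $(n,\epsilon)$-simulable from $p_{UV}$ via the conditional distributions $p_{X^n|U^n}$ and $p_{Y^n|V^n}$ if $$p_{X^nY^n}(x^n,y^n)=\sum_{u^n,v^n}p_{UV}^{\otimes n}(u^n,v^n)\,p_{X^n|U^n}(x^n|u^n)\,p_{Y^n|V^n}(y^n|v^n)$$ satisfies $D(p_{X^nY^n}\|p_{XY}^{\otimes n})\le\epsilon$, where $D$ is the Kullback–Leibler divergence. A coordinate permutation is the map $\sigma(x^n)=(x_{\sigma(1)},\dots,x_{\sigma(n)})$ induced by a permutation $\sigma$ of $[n]$. $d_{\mathsf{TV}}(P,Q)=\sup_A|P(A)-Q(A)|$ is the total variation distance. $D_1$ and $D_2$ are random variables, being functions of the random sequences $U^n$ and $V^n$ respectively. ''$D_j$ is bounded away from zero in probability'' means that there is a constant $c>0$ with $\liminf_{n\to\infty}\Pr(D_j\ge c)>0$.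
   Formalization: The first half is proved for 0 < p < 1/2 only; at p = 0 and p = 1/2 it is false: with δ = ε = 0, applying the prefix-XOR bijection of {0,1}^n to both inputs simulates exactly, yet D_1, D_2 ≥ 1/2 with probability at least 1/2. *)

(* Defs.v *)
From HB Require Import structures.
From mathcomp Require Export all_boot all_order all_algebra all_fingroup.
From mathcomp Require Export all_classical all_reals all_analysis.

Set Implicit Arguments.
Unset Strict Implicit.
Unset Printing Implicit Defensive.

Export Order.TTheory GRing.Theory Num.Theory.
Export numFieldNormedType.Exports.

#[export] Set Implicit Arguments.
#[global] Open Scope classical_set_scope.
#[global] Open Scope ring_scope.

Record fdist (R : realType) (T : finType) := Fdist {
  fdist_pmf :> T -> R ;
  fdist_ge0 : forall x, 0 <= fdist_pmf x ;
  fdist_sum1 : \sum_x fdist_pmf x = 1 }.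

(* W a b is the conditional probability of b given a. *)
Definition channel (R : realType) (A B : finType) := A -> fdist R B.

Definition bits (n : nat) := {ffun 'I_n -> bool}.

(* Natural logarithm. Since ln 0 = 0 in the library, terms with P x = 0
   vanish, and the divergence is +oo unless P is absolutely continuous with
   respect to Q. *)
Definition KL (R : realType) (T : finType) (P Q : T -> R) : \bar R :=
  if [forall x, (Q x == 0) ==> (P x == 0)]
  then (\sum_x P x * ln (P x / Q x))%:E
  else +oo%E.

(* The supremum over the finitely many events A; the values being
   nonnegative, the unit 0 of the iterated maximum is harmless. *)
Definition dTV (R : realType) (T : finType) (P Q : T -> R) : R :=
  \big[Num.max/0]_(A : {set T})
    `|\sum_(x in A) P x - \sum_(x in A) Q x|.

Definition dsbs (R : realType) (p : R) (uv : bool * bool) : R :=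
  if uv.1 == uv.2 then (1 - p) / 2 else p / 2.

(* The n-fold i.i.d. product of a joint law, as a law of pairs of sequences
   rather than of sequences of pairs. *)
Definition iid (R : realType) (S T : finType) (P : S * T -> R) (n : nat)
    (st : {ffun 'I_n -> S} * {ffun 'I_n -> T}) : R :=
  \prod_(i < n) P (st.1 i, st.2 i).

Definition simulated (R : realType) (n : nat) (pUV : bool * bool -> R)
    (K L : channel R (bits n) (bits n)) (xy : bits n * bits n) : R :=
  \sum_u \sum_v iid pUV (u, v) * K u xy.1 * L v xy.2.

Definition simulable (R : realType) (n : nat) (eps : R)
    (pUV pXY : bool * bool -> R) (K L : channel R (bits n) (bits n)) : Prop :=
  (KL (simulated pUV K L) (iid pXY (n := n)) <= eps%:E)%E.

Definition coord_perm (n : nat) (s : 'S_n) (x : bits n) : bits n :=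
  [ffun i => x (s i)].

(* The law of s(X^n) when X^n has law P. *)
Definition perm_law (R : realType) (n : nat) (s : 'S_n) (P : bits n -> R)
    (z : bits n) : R :=
  \sum_(x | coord_perm s x == z) P x.

Definition prod_channel (R : realType) (n : nat)
    (q : 'I_n -> channel R bool bool) (u z : bits n) : R :=
  \prod_(i < n) q i (u i) (z i).

(* The quantity D_1 (or D_2) at the realization u of the input sequence. *)
Definition scalar_gap (R : realType) (n : nat)
    (K : channel R (bits n) (bits n)) (s : 'S_n)
    (q : 'I_n -> channel R bool bool) (u : bits n) : R :=
  dTV (perm_law s (K u)) (prod_channel q u).

Definition Pr (R : realType) (T : finType) (P : T -> R) (E : pred T) : R :=
  \sum_(t | E t) P t.

(* D n is a real random variable on (U^n, V^n), distributed as the n-fold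
   i.i.d. product of pUV; convergence to 0 in probability as n -> oo. *)
Definition cvg0_in_prob (R : realType) (pUV : bool * bool -> R)
    (D : forall n, bits n * bits n -> R) : Prop :=
  forall eta : R, 0 < eta ->
    (fun n => Pr (iid pUV (n := n)) (fun uv => eta < D n uv)) @ \oo --> (0 : R).

Definition bounded_away_in_prob (R : realType) (pUV : bool * bool -> R)
    (D : forall n, bits n * bits n -> R) : Prop :=
  exists2 c : R, 0 < c &
    (0 < limn_einf
       (fun n => (Pr (iid pUV (n := n)) (fun uv => c <= D n uv))%:E))%E.

Definition little_o (R : realType) (a b : R^nat) : Prop := a =o_\oo b.

(* a = omega(b) *)
Definition little_omega (R : realType) (a b : R^nat) : Prop := little_o b a.

(* Main.v *)
Require Import Defs.
From mathcomp Require Import ring lra zify.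

Unset Strict Implicit.
Unset Printing Implicit Defensive.

(* Recovery.  Let f_i(u) = E[X_i | U = u] and g_i(v) = E[Y_i | V = v], with signs
   for bits.  By the Donsker-Varadhan inequality the means and correlations of
   (X, Y) are close to those of the target: the sum of the E[X_i Y_i] is
   n(1 - 2p) - o(1) and the sum of the |E X_i| is o(1).  Since the noise
   contracts degree k by (1 - 2p)^k, the f_i together lose only o(1) of their
   weight on degree 1; by Friedgut-Kalai-Naor each X_i is then a signed input
   coordinate, up to a total error probability o(1).  Approximate independence
   makes the coordinate map injective, and the correlation of X_i with Y_i makes
   it the same on both sides.

   Impossibility.  Take X = U + N and Y = V + M modulo 2, with independent noises
   N and M; the simulated law is governed by the product of their Fourier
   transforms.  For large delta, N forbids the value (1,1) on Theta(n) pairs of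
   coordinates, where a product law would give it total mass about
   n delta^2 -> oo, and M restores the exact target law (N and M exchange roles
   on further pairs, so that both channels are far from products).  For large epsilon, N flips at
   most one uniformly chosen coordinate, which costs divergence O(1/n) only.
   This needs p > 0; for p = 0 one has U = V, and any bijection of the inputs
   will do. *)

(** * Fourier analysis on the cube *)

(** Closeness is measured as a total over the n coordinates, because recovery ends in a union bound
    over them. This has two consequences. The change of measure is applied to a sum of n bounded
    test functions with a multiplier of order 1/n, so that the divergence and the shift of each
    target correlation are both paid n times: this is where epsilon, delta = o(1/n) enter. And the
    Friedgut-Kalai-Naor error has to be linear in the degree-1 defect of each coordinate, since only
    the sum of the defects is controlled. The constants carry 1 / (rho - rho^2) with rho = 1 - 2p,
    the gap between the damping of degree 1 and that of degree 2.

    Impossibility is shown at each fixed n: a gap of at least 1/200 with probability at least 1/2,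
    uniformly in the permutation and the scalar channels, so that any sequence of these can be
    inserted in the limit. *)

Definition xorv (n : nat) (u x : bits n) : bits n := [ffun i => u i (+) x i].

Definition sg (R : realType) (b : bool) : R := (-1) ^+ b.

Definition chi (R : realType) (n : nat) (S : {set 'I_n}) (u : bits n) : R :=
  \prod_(i in S) sg R (u i).

Definition avg (R : realType) (n : nat) (f : bits n -> R) : R :=
  (2 ^+ n)^-1 * \sum_u f u.

Definition hat (R : realType) (n : nat) (f : bits n -> R) (S : {set 'I_n}) : R :=
  avg (fun u => f u * chi R S u).

Lemma sum_ffun_prod (R : realType) (I T : finType) (F : I -> T -> R) :
  \sum_(f : {ffun I -> T}) \prod_i F i (f i) = \prod_i \sum_t F i t.
Proof. by rewrite bigA_distr_bigA. Qed.

Lemma sum_ffun2_prod (R : realType) (I S T : finType) (F : I -> S -> T -> R) :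
  \sum_(f : {ffun I -> S}) \sum_(g : {ffun I -> T}) \prod_i F i (f i) (g i) =
  \prod_i \sum_s \sum_t F i s t.
Proof.
rewrite -(sum_ffun_prod (fun i s => \sum_t F i s t)); apply: eq_bigr => f _.
exact: (sum_ffun_prod (fun i => F i (f i))).
Qed.

Lemma sum_bool (R : realType) (f : bool -> R) : \sum_b f b = f true + f false.
Proof. by rewrite big_bool. Qed.

Lemma sg_addb (R : realType) (b c : bool) : sg R (b (+) c) = sg R b * sg R c.
Proof. by rewrite /sg signr_addb. Qed.

Lemma chi_xor (R : realType) (n : nat) (S : {set 'I_n}) (u v : bits n) :
  chi R S (xorv u v) = chi R S u * chi R S v.
Proof. by rewrite -big_split; apply: eq_bigr => i _; rewrite ffunE sg_addb. Qed.

Lemma chi0 (R : realType) (n : nat) (u : bits n) : chi R finset.set0 u = 1.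
Proof. by rewrite /chi big_set0. Qed.

Lemma chi1 (R : realType) (n : nat) (i : 'I_n) (u : bits n) :
  chi R [set i]%SET u = sg R (u i).
Proof. by rewrite /chi big_set1. Qed.

Lemma chi_if (R : realType) (n : nat) (S : {set 'I_n}) (u : bits n) :
  chi R S u = \prod_i (if i \in S then sg R (u i) else 1).
Proof. by rewrite /chi big_mkcond. Qed.

Lemma dsbsE (R : realType) (p : R) (a b : bool) :
  dsbs p (a, b) = (1 + (1 - 2 * p) * (sg R a * sg R b)) / 4.
Proof. by case: a b => [] []; rewrite /dsbs /sg /=; field. Qed.

Lemma dsbs_ge0 (R : realType) (p : R) (ab : bool * bool) :
  0 <= p -> p <= 1 -> 0 <= dsbs p ab.
Proof. by move=> *; rewrite /dsbs; case: ifP => _; lra. Qed.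

Lemma iid_ge0 (R : realType) (p : R) (n : nat) (uv : bits n * bits n) :
  0 <= p -> p <= 1 -> 0 <= iid (dsbs p) uv.
Proof. by move=> *; apply: prodr_ge0 => i _; exact: dsbs_ge0. Qed.

(** Expanding the product of [dsbsE] over subsets: the characters diagonalize the source, with
    eigenvalue [(1 - 2 * p) ^+ #|S|] at [S]. *)
Lemma iid_chi (R : realType) (p : R) (n : nat) (u v : bits n) :
  iid (dsbs p) (u, v) =
  (4 ^+ n)^-1 *
    \sum_(S : {set 'I_n}) (1 - 2 * p) ^+ #|S| * chi R S u * chi R S v.
Proof.
rewrite /iid /=; under eq_bigr do rewrite dsbsE addrC.
rewrite big_split /= [X in _ * X]prodr_const card_ord exprVn mulrC; congr (_ * _).
rewrite bigA_distr; apply: eq_bigr => S _.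
rewrite [LHS](bigID (mem S)) /= [X in _ * X]big1 ?mulr1; last first.
  by move=> i /negbTE ->.
rewrite (eq_bigr (fun i => (1 - 2 * p) * (sg R (u i) * sg R (v i)))); last first.
  by move=> i ->.
by rewrite big_split /= big_split /= prodr_const mulrA.
Qed.

Lemma iid_marginal (R : realType) (p : R) (n : nat) (u : bits n) :
  \sum_v iid (dsbs p) (u, v) = (2 ^+ n)^-1.
Proof.
rewrite /iid /= (sum_ffun_prod (fun i t => dsbs p (u i, t))).
rewrite (eq_bigr (fun _ => 2^-1)) ?prodr_const ?card_ord ?exprVn // => i _.
by rewrite sum_bool !dsbsE /sg; case: (u i) => /=; field.
Qed.

Lemma iidC (R : realType) (p : R) (n : nat) (u v : bits n) :
  iid (dsbs p) (u, v) = iid (dsbs p) (v, u).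
Proof. by apply: eq_bigr => i _; rewrite /dsbs /= eq_sym. Qed.

Lemma iid_marginalr (R : realType) (p : R) (n : nat) (v : bits n) :
  \sum_u iid (dsbs p) (u, v) = (2 ^+ n)^-1.
Proof. by under eq_bigr do rewrite iidC; exact: iid_marginal. Qed.

Lemma avg_const (R : realType) (n : nat) (c : R) : avg (fun _ : bits n => c) = c.
Proof.
rewrite /avg sumr_const card_ffun card_bool card_ord -[c *+ _]mulr_natl
 natrX mulrA.
by rewrite mulVf ?mul1r // expf_neq0 // pnatr_eq0.
Qed.

Lemma iid_sum1 (R : realType) (p : R) (n : nat) :
  \sum_(uv : bits n * bits n) iid (dsbs p) uv = 1.
Proof.
rewrite -(pair_bigA _ (fun u v => iid (dsbs p) (u, v))) /=.
under eq_bigr do rewrite iid_marginal.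
by rewrite -[RHS](avg_const n 1) /avg mulr_sumr; apply: eq_bigr => u _; rewrite mulr1.
Qed.

Lemma iid_dsbs0 (R : realType) (n : nat) (u v : bits n) :
  iid (dsbs (0 : R)) (u, v) = (2 ^+ n)^-1 * (u == v)%:R.
Proof.
rewrite /iid /=; case: (u =P v) => [->|/eqP neq_uv].
  rewrite (eq_bigr (fun _ => 2^-1)) ?prodr_const ?card_ord ?exprVn ?mulr1 // => i _.
  by rewrite /dsbs /= eqxx subr0 mul1r.
have [i nei] : exists i, u i != v i.
  apply/existsP; apply: contraNT neq_uv; rewrite negb_exists => /forallP h.
  by apply/eqP/ffunP => i; apply/eqP; move: (h i); rewrite negbK.
by rewrite (bigD1 i) //= /dsbs /= (negbTE nei) mul0r mul0r mulr0.
Qed.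

Lemma corr_hat (R : realType) (p : R) (n : nat) (f g : bits n -> R) :
  \sum_u \sum_v iid (dsbs p) (u, v) * f u * g v =
  \sum_(S : {set 'I_n}) (1 - 2 * p) ^+ #|S| * hat f S * hat g S.
Proof.
transitivity (\sum_u \sum_v \sum_(S : {set 'I_n}) (1 - 2 * p) ^+ #|S| *
    ((2 ^+ n)^-1 * (f u * chi R S u)) * ((2 ^+ n)^-1 * (g v * chi R S v))).
  apply: eq_bigr => u _; apply: eq_bigr => v _.
  rewrite iid_chi -!mulrA mulr_suml mulr_sumr; apply: eq_bigr => S _.
  have -> : (4 ^+ n)^-1 = (2 ^+ n)^-1 * (2 ^+ n)^-1 :> R.
    by rewrite -invfM -exprMn; congr (_ ^+ _)^-1; ring.
  by ring.
under eq_bigr => u _ do rewrite exchange_big /=.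
rewrite exchange_big /=; apply: eq_bigr => S _.
rewrite /hat /avg -!mulrA mulr_suml mulr_sumr mulr_sumr; apply: eq_bigr => u _.
by rewrite -mulr_sumr -mulr_sumr -!mulrA.
Qed.

(** This is [corr_hat] at p = 0, where U = V. *)
Lemma parseval (R : realType) (n : nat) (f : bits n -> R) :
  avg (fun u => f u ^+ 2) = \sum_(S : {set 'I_n}) hat f S ^+ 2.
Proof.
transitivity (\sum_(S : {set 'I_n}) (1 - 2 * 0) ^+ #|S| * hat f S * hat f S).
  rewrite -corr_hat /avg mulr_sumr; apply: eq_bigr => u _.
  rewrite (bigD1 u) //= big1 ?addr0 ?iid_dsbs0 ?eqxx => [|v nvu].
    by rewrite mulr1 expr2 mulrA.
  by rewrite iid_dsbs0 eq_sym (negbTE nvu) mulr0 !mul0r.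
by apply: eq_bigr => S _; rewrite mulr0 subr0 expr1n mul1r expr2.
Qed.

(** * Rademacher sums and the Friedgut-Kalai-Naor theorem *)

Definition flip (n : nat) (k : 'I_n) (u : bits n) : bits n :=
  [ffun i => u i (+) (i == k)].

Lemma flipK (n : nat) (k : 'I_n) : involutive (flip k).
Proof. by move=> u; apply/ffunP => i; rewrite !ffunE -addbA addbb addbF. Qed.

Lemma avg_flip (R : realType) (n : nat) (k : 'I_n) (f : bits n -> R) :
  avg (fun u => f (flip k u)) = avg f.
Proof.
rewrite /avg; congr (_ * _); symmetry; apply: reindex.
by exists (flip k) => u _; rewrite flipK.
Qed.

Lemma sg_flip (R : realType) (n : nat) (k j : 'I_n) (u : bits n) :
  sg R (flip k u j) = if j == k then - sg R (u j) else sg R (u j).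
Proof. by rewrite ffunE sg_addb; case: eqP => _; rewrite /sg /= ?mulrN1 ?mulr1. Qed.

Lemma avgD (R : realType) (n : nat) (f g : bits n -> R) :
  avg (fun u => f u + g u) = avg f + avg g.
Proof. by rewrite /avg big_split mulrDr. Qed.

Lemma avgZ (R : realType) (n : nat) (c : R) (f : bits n -> R) :
  avg (fun u => c * f u) = c * avg f.
Proof. by rewrite /avg -mulr_sumr mulrCA. Qed.

Lemma avgN (R : realType) (n : nat) (f : bits n -> R) :
  avg (fun u => - f u) = - avg f.
Proof. by rewrite /avg sumrN mulrN. Qed.

Lemma avg_sum (R : realType) (n : nat) (I : finType) (f : I -> bits n -> R) :
  avg (fun u => \sum_i f i u) = \sum_i avg (f i).
Proof. by rewrite /avg exchange_big mulr_sumr. Qed.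

Lemma eq_avg (R : realType) (n : nat) (f g : bits n -> R) :
  f =1 g -> avg f = avg g.
Proof. by move=> e; rewrite /avg; congr (_ * _); apply: eq_bigr => u _. Qed.

Lemma pow2_gt0 (R : realType) (n : nat) : 0 < (2 ^+ n)^-1 :> R.
Proof. by rewrite invr_gt0 exprn_gt0. Qed.

Lemma avg_le (R : realType) (n : nat) (f g : bits n -> R) :
  (forall u, f u <= g u) -> avg f <= avg g.
Proof.
move=> h; rewrite /avg ler_wpM2l ?(ltW (pow2_gt0 _ _)) //.
by apply: ler_sum => u _.
Qed.

Lemma avg_ge0 (R : realType) (n : nat) (f : bits n -> R) :
  (forall u, 0 <= f u) -> 0 <= avg f.
Proof. by move=> h; rewrite -(avg_const n (0 : R)); exact: avg_le. Qed.

(** The part odd in [u k] cancels under the flip of [k]. The moment inductions below add one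
    variable at a time in this way. *)
Lemma avg_step (R : realType) (n : nat) (k : 'I_n) (f g : bits n -> R) :
  (forall u, f (flip k u) = f u) -> (forall u, g (flip k u) = g u) ->
  avg (fun u => f u + sg R (u k) * g u) = avg f.
Proof.
move=> hf hg; rewrite avgD [X in _ + X](_ : _ = 0) ?addr0 //.
have := avg_flip k (fun u => sg R (u k) * g u).
under eq_avg => u do rewrite sg_flip eqxx hg mulNr.
by rewrite avgN => /eqP; rewrite eq_sym -addr_eq0 -mulr2n mulrn_eq0 /= => /eqP.
Qed.

Lemma avg_CS (R : realType) (n : nat) (f g : bits n -> R) :
  avg (fun u => f u * g u) ^+ 2 <=
  avg (fun u => f u ^+ 2) * avg (fun u => g u ^+ 2).
Proof.
set A := avg (fun u => f u ^+ 2); set B := avg (fun u => f u * g u).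
set C := avg (fun u => g u ^+ 2).
have quad t : 0 <= t ^+ 2 * A - 2 * t * B + C.
  have := @avg_ge0 R n (fun u => (t * f u - g u) ^+ 2) (fun u => sqr_ge0 _).
  rewrite (@eq_avg _ _ _ (fun u => t ^+ 2 * f u ^+ 2 +
    ((- (2 * t)) * (f u * g u) + g u ^+ 2))); last by move=> u; ring.
  by rewrite avgD avgD !avgZ addrA mulNr.
have A0 : 0 <= A by apply: avg_ge0 => u; exact: sqr_ge0.
have [A_eq0|An0] := eqVneq A 0.
  have [->|Bn0] := eqVneq B 0; first by rewrite expr0n A_eq0 mul0r.
  (* With A = 0 the quadratic is affine in t, and this t gives it the value -1. *)
  have := quad ((C + 1) / (2 * B)); rewrite A_eq0.
  have -> : ((C + 1) / (2 * B)) ^+ 2 * 0 - 2 * ((C + 1) / (2 * B)) * B + C = -1.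
    by field.
  by rewrite ler0N1.
have Agt : 0 < A by rewrite lt_neqAle eq_sym An0.
have := quad (B / A); rewrite (_ : _ + C = (A * C - B ^+ 2) / A); last by field.
by rewrite pmulr_lge0 ?invr_gt0 // subr_ge0.
Qed.

Definition lin (R : realType) (n : nat) (a : 'I_n -> R) (s : seq 'I_n)
    (u : bits n) : R :=
  \sum_(j <- s) a j * sg R (u j).

Definition wt (R : realType) (n : nat) (a : 'I_n -> R) (s : seq 'I_n) : R :=
  \sum_(j <- s) a j ^+ 2.

Lemma lin_flip (R : realType) (n : nat) (a : 'I_n -> R) (s : seq 'I_n) k u :
  k \notin s -> lin a s (flip k u) = lin a s u.
Proof.
move=> ks; apply: eq_big_seq => j js; rewrite sg_flip ifN //.
by apply: contraNneq ks => <-.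
Qed.

Lemma wt_ge0 (R : realType) (n : nat) (a : 'I_n -> R) (s : seq 'I_n) :
  0 <= wt a s.
Proof. by apply: sumr_ge0 => j _; exact: sqr_ge0. Qed.

Lemma lin_moment2 (R : realType) (n : nat) (a : 'I_n -> R) (s : seq 'I_n) :
  uniq s -> avg (fun u => lin a s u ^+ 2) = wt a s.
Proof.
elim: s => [_|k s IH /= /andP[ks us]].
  by under eq_avg do rewrite /lin big_nil expr0n; rewrite avg_const /wt big_nil.
rewrite (@eq_avg _ _ _ (fun u => (a k ^+ 2 + lin a s u ^+ 2) +
  sg R (u k) * (2 * a k * lin a s u))); last first.
  move=> u; rewrite /lin big_cons -/(lin a s u).
  by case: (u k); rewrite /sg /=; ring.
rewrite avg_step ?avgD ?avg_const ?IH // ?/wt ?big_cons // => u.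
  by rewrite lin_flip.
by rewrite lin_flip.
Qed.

(** A new coefficient of square x turns the bound 3 W^2 into x^2 + 6 x W + 3 W^2, which is at most 3
    (W + x)^2. *)
Lemma lin_moment4 (R : realType) (n : nat) (a : 'I_n -> R) (s : seq 'I_n) :
  uniq s -> avg (fun u => lin a s u ^+ 4) <= 3 * wt a s ^+ 2.
Proof.
elim: s => [_|k s IH /= /andP[ks us]].
  under eq_avg do rewrite /lin big_nil expr0n.
  by rewrite avg_const /wt big_nil expr0n mulr0.
rewrite (@eq_avg _ _ _ (fun u => (a k ^+ 4 + (6 * a k ^+ 2 * lin a s u ^+ 2
    + lin a s u ^+ 4)) +
  sg R (u k) * (4 * a k * lin a s u ^+ 3 + 4 * a k ^+ 3 * lin a s u))); last first.
  move=> u; rewrite /lin big_cons -/(lin a s u).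
  by case: (u k); rewrite /sg /=; ring.
rewrite avg_step; [|by move=> u; rewrite lin_flip..].
rewrite 2!avgD avg_const avgZ lin_moment2 // /wt big_cons -/(wt a s).
have := IH us; have := wt_ge0 a s; have := sqr_ge0 (a k).
rewrite (_ : a k ^+ 4 = (a k ^+ 2) ^+ 2); last by ring.
move: (a k ^+ 2) (wt a s) => x W x0 W0 h; nra.
Qed.

Lemma lin_variance (R : realType) (n : nat) (a : 'I_n -> R) (s : seq 'I_n) :
  uniq s -> avg (fun u => (lin a s u ^+ 2 - wt a s) ^+ 2) =
  2 * (wt a s ^+ 2 - \sum_(j <- s) a j ^+ 4).
Proof.
elim: s => [_|k s IH /= /andP[ks us]].
  under eq_avg do rewrite /lin /wt !big_nil expr0n subr0 expr0n.
  by rewrite avg_const /wt !big_nil expr0n subrr mulr0.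
rewrite (@eq_avg _ _ _ (fun u => (4 * a k ^+ 2 * lin a s u ^+ 2
    + (lin a s u ^+ 2 - wt a s) ^+ 2) +
  sg R (u k) * (4 * a k * lin a s u * (lin a s u ^+ 2 - wt a s)))); last first.
  move=> u; rewrite /lin /wt !big_cons -/(lin a s u) -/(wt a s).
  by case: (u k); rewrite /sg /=; ring.
rewrite avg_step; [|by move=> u; rewrite lin_flip..].
rewrite avgD avgZ lin_moment2 // IH // /wt !big_cons -/(wt a s); ring.
Qed.

(* Both sides grow by one coefficient [a] at a time: with V and W the second
   moments of [lin ^+ 2 - wt] and [lin], the left side gains at most
   648 a^2 V W + 144 a^4 W^2 by Cauchy-Schwarz, less than the gain of
   81 (V + 4 a^2 W)^2 on the right. *)
Lemma lin_hypercontractive (R : realType) (n : nat) (a : 'I_n -> R) (s : seq 'I_n) :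
  uniq s -> avg (fun u => (lin a s u ^+ 2 - wt a s) ^+ 4) <=
  81 * avg (fun u => (lin a s u ^+ 2 - wt a s) ^+ 2) ^+ 2.
Proof.
elim: s => [_|k s IH /= /andP[ks us]].
  under eq_avg do rewrite /lin /wt !big_nil expr0n subr0 expr0n.
  by rewrite avg_const mulr_ge0 // sqr_ge0.
rewrite (@eq_avg _ _ _ (fun u => ((lin a s u ^+ 2 - wt a s) ^+ 4 +
   ((24 * a k ^+ 2) * ((lin a s u ^+ 2 - wt a s) ^+ 2 * lin a s u ^+ 2) +
    16 * a k ^+ 4 * lin a s u ^+ 4)) +
  sg R (u k) * (8 * a k * lin a s u * (lin a s u ^+ 2 - wt a s) ^+ 3 +
   32 * a k ^+ 3 * lin a s u ^+ 3 * (lin a s u ^+ 2 - wt a s)))); last first.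
  move=> u; rewrite /lin /wt !big_cons -/(lin a s u) -/(wt a s).
  by case: (u k); rewrite /sg /=; ring.
rewrite avg_step; [|by move=> u; rewrite lin_flip..].
rewrite (@eq_avg _ _ (fun u => (lin a (k :: s) u ^+ 2 - wt a (k :: s)) ^+ 2)
  (fun u => (4 * a k ^+ 2 * lin a s u ^+ 2
    + (lin a s u ^+ 2 - wt a s) ^+ 2) +
  sg R (u k) * (4 * a k * lin a s u * (lin a s u ^+ 2 - wt a s)))); last first.
  move=> u; rewrite /lin /wt !big_cons -/(lin a s u) -/(wt a s).
  by case: (u k); rewrite /sg /=; ring.
rewrite avg_step; [|by move=> u; rewrite lin_flip..].
rewrite !avgD !avgZ lin_moment2 //.
have := avg_CS (fun u => (lin a s u ^+ 2 - wt a s) ^+ 2) (fun u => lin a s u ^+ 2).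
rewrite (@eq_avg _ _ (fun u => ((lin a s u ^+ 2 - wt a s) ^+ 2) ^+ 2)
  (fun u => (lin a s u ^+ 2 - wt a s) ^+ 4)); last by move=> u; ring.
rewrite (@eq_avg _ _ (fun u => (lin a s u ^+ 2) ^+ 2)
  (fun u => lin a s u ^+ 4)); last by move=> u; ring.
have := lin_moment4 a us; have := IH us; have := wt_ge0 a s.
have := sqr_ge0 (a k).
have : 0 <= avg (fun u => (lin a s u ^+ 2 - wt a s) ^+ 2).
  by apply: avg_ge0 => u; exact: sqr_ge0.
have : 0 <= avg (fun u => (lin a s u ^+ 2 - wt a s) ^+ 2 * lin a s u ^+ 2).
  by apply: avg_ge0 => u; rewrite mulr_ge0 // sqr_ge0.
have : 0 <= avg (fun u => (lin a s u ^+ 2 - wt a s) ^+ 4).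
  by apply: avg_ge0 => u; rewrite exprn_even_ge0.
have : 0 <= avg (fun u => lin a s u ^+ 4).
  by apply: avg_ge0 => u; rewrite exprn_even_ge0.
rewrite (_ : a k ^+ 4 = (a k ^+ 2) ^+ 2); last by ring.
set L := avg (fun u => lin a s u ^+ 4).
set Q := avg (fun u => (lin a s u ^+ 2 - wt a s) ^+ 4).
set M := avg (fun u => (lin a s u ^+ 2 - wt a s) ^+ 2 * lin a s u ^+ 2).
set V := avg (fun u => (lin a s u ^+ 2 - wt a s) ^+ 2).
move: L Q M V (a k ^+ 2) (wt a s).
move=> L Q M V x W L0 Q0 M0 V0 x0 W0 QV LW MQL.
(* Cauchy-Schwarz gives M^2 <= 243 (V W)^2. The factor 27 is what the cross term allows: 24 * 27 =
   648 = 81 * 2 * 4. *)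
have MVW : M <= 27 * (V * W).
  have VW0 : 0 <= V * W by rewrite mulr_ge0.
  rewrite -(@ler_pXn2r _ 2) ?nnegrE ?mulr_ge0 //; apply: (le_trans MQL).
  apply: (@le_trans _ _ ((81 * V ^+ 2) * (3 * W ^+ 2))); first exact: ler_pM.
  have := sqr_ge0 (V * W); rewrite !exprMn; lra.
have h1 : x * M <= x * (27 * (V * W)) by rewrite ler_wpM2l.
have h2 : x ^+ 2 * L <= x ^+ 2 * (3 * W ^+ 2) by rewrite ler_wpM2l // sqr_ge0.
have h3 : 0 <= x ^+ 2 * W ^+ 2 by rewrite mulr_ge0 // sqr_ge0.
rewrite (_ : 81 * _ = 81 * V ^+ 2 + 648 * (x * (V * W)) + 1296 * (x ^+ 2 * W ^+ 2));
  last by ring.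
lra.
Qed.

Definition lev1 (R : realType) (n : nat) (f : bits n -> R) : R :=
  \sum_j hat f [set j]%SET ^+ 2.

Lemma hat1 (R : realType) (n : nat) (f : bits n -> R) (j : 'I_n) :
  hat f [set j]%SET = avg (fun u => f u * sg R (u j)).
Proof. by apply: eq_avg => u; rewrite chi1. Qed.

(** Truncation at t: the first term suffices when |y| <= t, the second when |y| > t. *)
Lemma sqr_le_split (R : realType) (y t : R) :
  0 < t -> y ^+ 2 <= t * `|y| + y ^+ 4 / t ^+ 2.
Proof.
move=> t0; have y4 : 0 <= y ^+ 4 by rewrite exprn_even_ge0.
have [yt|ty] := lerP `|y| t.
  rewrite -(real_normK (num_real y)) expr2 ler_wpDr ?divr_ge0 ?sqr_ge0 //.
  by rewrite ler_wpM2r.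
rewrite ler_wpDl ?mulr_ge0 ?(ltW t0) // ler_pdivlMr ?exprn_gt0 //.
rewrite (_ : y ^+ 4 = y ^+ 2 * y ^+ 2); last by ring.
rewrite ler_wpM2l ?sqr_ge0 // -(real_normK (num_real y)).
by rewrite ler_pXn2r ?nnegrE ?(ltW t0) // ltW.
Qed.

(** A fourth moment bounded by the square of the second prevents concentration on a small set, so
    the L1 norm controls the L2 norm. *)
Lemma lin_spread (R : realType) (n : nat) (a : 'I_n -> R) (s : seq 'I_n) :
  uniq s -> avg (fun u => (lin a s u ^+ 2 - wt a s) ^+ 2) <=
  648 * avg (fun u => `|lin a s u ^+ 2 - wt a s|) ^+ 2.
Proof.
move=> us; set q := fun u => lin a s u ^+ 2 - wt a s.
have : 0 <= avg (fun u => q u ^+ 2) by apply: avg_ge0 => u; exact: sqr_ge0.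
rewrite le_eqVlt => /orP[/eqP<-|V0]; first by rewrite mulr_ge0 ?sqr_ge0.
(* With t^2 = 162 V the fourth-moment term is at most 81 V^2 / t^2 = V / 2 and is absorbed; then V
   <= 2 t A, and 4 * 162 = 648. *)
set V := avg _ in V0 *; set A := avg _; set t := Num.sqrt (162 * V).
have t0 : 0 < t by rewrite sqrtr_gt0 mulr_gt0.
have t2 : t ^+ 2 = 162 * V by rewrite sqr_sqrtr // mulr_ge0 // ltW.
have h4 : avg (fun u => q u ^+ 4) <= 81 * V ^+ 2 by exact: lin_hypercontractive.
have h : V <= t * A + V / 2.
  apply: (@le_trans _ _ (t * A + (t ^+ 2)^-1 * avg (fun u => q u ^+ 4))).
    rewrite -!avgZ -avgD; apply: avg_le => u.
    by rewrite [(t ^+ 2)^-1 * _]mulrC; exact: sqr_le_split.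
  rewrite lerD2l t2; apply: (@le_trans _ _ ((162 * V)^-1 * (81 * V ^+ 2))).
    by rewrite ler_wpM2l // invr_ge0 mulr_ge0 // ltW.
  by rewrite le_eqVlt; apply/orP; left; apply/eqP; field; rewrite gt_eqF.
have A0 : 0 <= A by apply: avg_ge0 => u.
have h2 : (V / 2) ^+ 2 <= (t * A) ^+ 2.
  have tA0 : 0 <= t * A by rewrite mulr_ge0 // ltW.
  by rewrite ler_pXn2r ?nnegrE //; lra.
have h3 : V * V <= V * (648 * A ^+ 2).
  have -> : V * V = 4 * (V / 2) ^+ 2 by field.
  have -> : V * (648 * A ^+ 2) = 4 * (t * A) ^+ 2 by rewrite [(t * A) ^+ 2]exprMn t2; ring.
  by rewrite ler_pM2l.
by rewrite ler_pM2l in h3.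
Qed.

(* Friedgut-Kalai-Naor: the linear part l of f is L2-close to f, so that l^2
   is L1-close to 1; by hypercontractivity its variance 2 (W^2 - sum a_j^4) is
   then small, which forces one coefficient to dominate. *)
Lemma fkn (R : realType) (n : nat) (f : bits n -> R) (i0 : 'I_n) :
  (forall u, `|f u| <= 1) ->
  lev1 f <= 1 /\
  exists j, 1 - 5200 * (1 - lev1 f) <= hat f [set j]%SET ^+ 2.
Proof.
move=> f1; pose a j := hat f [set j]%SET; pose s := index_enum 'I_n.
have us : uniq s by exact: index_enum_uniq.
pose l := lin a s; have WE : lev1 f = wt a s by [].
have fsq u : f u ^+ 2 <= 1 by rewrite -(real_normK (num_real _)) expr_le1.
have Ef : avg (fun u => f u ^+ 2) <= 1.
  by rewrite -[leRHS](avg_const n (1 : R)); exact: avg_le.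
have Efl : avg (fun u => f u * l u) = wt a s.
  rewrite (@eq_avg _ _ _ (fun u => \sum_j a j * (f u * sg R (u j)))); last first.
    by move=> u; rewrite /l /lin mulr_sumr; apply: eq_bigr => j _; rewrite mulrCA.
  by rewrite avg_sum; apply: eq_bigr => j _; rewrite avgZ -hat1 expr2.
have El : avg (fun u => l u ^+ 2) = wt a s by exact: lin_moment2.
have Edist : avg (fun u => (l u - f u) ^+ 2) = avg (fun u => f u ^+ 2) - wt a s.
  rewrite (@eq_avg _ _ _ (fun u => l u ^+ 2 + (-2 * (f u * l u) + f u ^+ 2)));
    last by move=> u; ring.
  by rewrite 2!avgD avgZ El Efl; ring.
have Esum : avg (fun u => (l u + f u) ^+ 2) = avg (fun u => f u ^+ 2) + 3 * wt a s.
  rewrite (@eq_avg _ _ _ (fun u => l u ^+ 2 + (2 * (f u * l u) + f u ^+ 2)));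
    last by move=> u; ring.
  by rewrite 2!avgD avgZ El Efl; ring.
have Ed0 : 0 <= avg (fun u => (l u - f u) ^+ 2).
  by apply: avg_ge0 => u; exact: sqr_ge0.
have W0 := wt_ge0 a s.
rewrite WE; have W1 : wt a s <= 1 by lra.
split=> //; set W := wt a s in WE Efl El Edist Esum W0 W1 *.
set T := avg (fun u => `|l u ^+ 2 - f u ^+ 2|).
have T0 : 0 <= T by apply: avg_ge0 => u.
(* Factor l^2 - f^2 and apply Cauchy-Schwarz: the two factors have second moments at most 1 - W and
   4. *)
have T2 : T ^+ 2 <= 4 * (1 - W).
  have := avg_CS (fun u => `|l u - f u|) (fun u => `|l u + f u|).
  rewrite (@eq_avg _ _ (fun u => `|l u - f u| * `|l u + f u|)
    (fun u => `|l u ^+ 2 - f u ^+ 2|)); last by move=> u; rewrite -normrM subr_sqr.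
  rewrite (@eq_avg _ _ (fun u => `|l u - f u| ^+ 2) (fun u => (l u - f u) ^+ 2));
    last by move=> u; rewrite real_normK ?num_real.
  rewrite (@eq_avg _ _ (fun u => `|l u + f u| ^+ 2) (fun u => (l u + f u) ^+ 2));
    last by move=> u; rewrite real_normK ?num_real.
  rewrite -/T Edist Esum => /le_trans; apply.
  set F := avg _ in Ef *; have F0 : 0 <= F - W by rewrite -Edist.
  apply: (@le_trans _ _ ((1 - W) * 4)); last by rewrite mulrC.
  by apply: ler_pM; lra.
have h := lin_spread a us; rewrite lin_variance // -/W -/l in h.
have Eq : avg (fun u => `|l u ^+ 2 - W|) <= T + 2 * (1 - W).
  apply: (@le_trans _ _ (T + (avg (fun u => 1 - f u ^+ 2) + (1 - W)))); last first.
    have : avg (fun u : bits n => 1 - f u ^+ 2) = 1 - avg (fun u => f u ^+ 2).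
      by rewrite avgD avgN avg_const.
    rewrite lerD2l => ->; have := Ed0; rewrite Edist; lra.
  rewrite -[X in _ + (_ + X)](avg_const n) -avgD -avgD; apply: avg_le => u.
  have := fsq u; rewrite -subr_ge0 => h1.
  rewrite (_ : l u ^+ 2 - W = (l u ^+ 2 - f u ^+ 2) + (- (1 - f u ^+ 2) + (1 - W)));
    last by ring.
  apply: (le_trans (ler_normD _ _)); rewrite lerD2l.
  apply: (le_trans (ler_normD _ _)); rewrite normrN ger0_norm // ger0_norm //.
  by rewrite subr_ge0.
have Eq0 : 0 <= avg (fun u => `|l u ^+ 2 - W|) by apply: avg_ge0 => u.
(* 2 T^2 + 8 (1 - W)^2 is at most 16 (1 - W), as 0 <= 1 - W <= 1. *)
have Eq2 : avg (fun u => `|l u ^+ 2 - W|) ^+ 2 <= 16 * (1 - W).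
  apply: (@le_trans _ _ ((T + 2 * (1 - W)) ^+ 2)).
    by rewrite ler_pXn2r ?nnegrE //; lra.
  have := sqr_ge0 (T - 2 * (1 - W)); nra.
exists [arg max_(j > i0) a j ^+ 2]%O; case: arg_maxP => // j _ jmax.
(* The sum of fourth powers is at most the largest square times the total weight W <= 1. *)
have F4 : \sum_(i <- s) a i ^+ 4 <= a j ^+ 2.
  apply: (@le_trans _ _ (a j ^+ 2 * W)); last first.
    by rewrite -[leRHS]mulr1 ler_wpM2l ?sqr_ge0.
  rewrite /W /wt mulr_sumr; apply: ler_sum => i _.
  rewrite (_ : a i ^+ 4 = a i ^+ 2 * a i ^+ 2); last by ring.
  by rewrite ler_wpM2r ?sqr_ge0 //; exact: jmax.
(* The variance bound gives W^2 - 5184 (1 - W) <= a_j^2, where 5184 = 648 * 16 / 2; replacing W^2 by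
   1 - 2 (1 - W) makes 5186, rounded up to 5200. *)
rewrite -/(a j); have := sqr_ge0 (1 - W); nra.
Qed.

(** * Entropy bounds on the simulated law *)

(** Donsker-Varadhan: integrate z <= e^z - 1 against P with z = phi - b - ln (P/Q). The exponential
    turns P into Q e^(phi - b), of total mass at most 1. *)
Lemma gibbs (R : realType) (T : finType) (P Q phi : T -> R) (eps b : R) :
  (forall x, 0 <= P x) -> (forall x, 0 <= Q x) -> \sum_x P x = 1 ->
  (KL P Q <= eps%:E)%E ->
  \sum_x Q x * expR (phi x) <= expR b -> \sum_x P x * phi x <= eps + b.
Proof.
move=> P0 Q0 P1; rewrite /KL; case: forallP => // ac; rewrite lee_fin => KLe hb.
suff h : \sum_x P x * (phi x - b - ln (P x / Q x)) <= 0.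
  have : \sum_x P x * (phi x - b - ln (P x / Q x)) =
     \sum_x P x * phi x - b - \sum_x P x * ln (P x / Q x).
    under eq_bigr do rewrite mulrBr mulrBr.
    by rewrite !sumrB -mulr_suml P1 mul1r.
  lra.
apply: (@le_trans _ _ (\sum_x (Q x * expR (phi x) * expR (- b) - P x))); last first.
  rewrite sumrB P1 -mulr_suml subr_le0.
  apply: (@le_trans _ _ (expR b * expR (- b))); first by rewrite ler_wpM2r ?expR_ge0.
  by rewrite -expRD subrr expR0.
apply: ler_sum => x _; have [->|Pn0] := eqVneq (P x) 0.
  by rewrite mul0r subr0 !mulr_ge0 ?expR_ge0.
have Pgt : 0 < P x by rewrite lt_neqAle eq_sym Pn0 P0.
have Qgt : 0 < Q x.
  rewrite lt_neqAle eq_sym Q0 andbT; apply/negP => Qx0.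
  by move: (ac x); rewrite Qx0 (negbTE Pn0).
have -> : Q x * expR (phi x) * expR (- b) - P x =
    P x * (expR (phi x - b - ln (P x / Q x)) - 1).
  rewrite !expRD expRN [expR (- ln _)]expRN lnK ?posrE ?divr_gt0 //.
  by field; rewrite !gt_eqF ?expR_gt0.
by rewrite ler_pM2l // lerBrDl expR_ge1Dx.
Qed.

Lemma expR_le_quadratic (R : realType) (x : R) :
  `|x| <= 1 / 2 -> expR x <= 1 + x + 2 * x ^+ 2.
Proof.
rewrite ler_norml => /andP[x1 x2].
have h : (1 - x) * expR x <= 1.
  rewrite -[leRHS](expRxMexpNx_1 x) mulrC ler_wpM2l ?expR_ge0 //.
  exact: (expR_ge1Dx (- x)).
have h1 : (1 - x) * expR x <= (1 - x) * (1 + x + 2 * x ^+ 2).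
  apply: (le_trans h); have : 0 <= x ^+ 2 * (1 - 2 * x).
    by rewrite mulr_ge0 ?sqr_ge0 //; lra.
  lra.
by rewrite ler_pM2l in h1; lra.
Qed.

Lemma mgf_le (R : realType) (T : finType) (Q phi : T -> R) (lam : R) :
  (forall x, 0 <= Q x) -> \sum_x Q x = 1 -> (forall x, `|phi x| <= 1) ->
  \sum_x Q x * phi x = 0 -> 0 <= lam -> lam <= 1 / 2 ->
  \sum_x Q x * expR (lam * phi x) <= expR (2 * lam ^+ 2).
Proof.
move=> Q0 Q1 phi1 Qphi l0 l1.
apply: (@le_trans _ _ (1 + 2 * lam ^+ 2)); last exact: expR_ge1Dx.
apply: (@le_trans _ _ (\sum_x Q x * (1 + lam * phi x + 2 * lam ^+ 2))).
  apply: ler_sum => x _; rewrite ler_wpM2l //.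
  have phix := phi1 x.
  have : `|lam * phi x| <= lam by rewrite normrM ger0_norm // ler_piMr.
  move=> h; apply: (le_trans (expR_le_quadratic (le_trans h l1))).
  rewrite lerD2l ler_pM2l // -(real_normK (num_real (lam * phi x))).
  by rewrite ler_pXn2r ?nnegrE.
under eq_bigr do rewrite addrAC mulrDr [X in _ + X]mulrCA.
by rewrite big_split /= -mulr_suml Q1 mul1r -mulr_sumr Qphi mulr0 addr0.
Qed.

Lemma mgf_iid_le (R : realType) (n : nat) (q : R)
    (phi : 'I_n -> bool * bool -> R) (lam : R) :
  0 <= q -> q <= 1 -> (forall i ab, `|phi i ab| <= 1) ->
  (forall i, \sum_a \sum_b dsbs q (a, b) * phi i (a, b) = 0) ->
  0 <= lam -> lam <= 1 / 2 ->
  \sum_(xy : bits n * bits n)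
     iid (dsbs q) xy * expR (lam * \sum_i phi i (xy.1 i, xy.2 i)) <=
  expR (n%:R * (2 * lam ^+ 2)).
Proof.
move=> q0 q1 phi1 phi0 l0 l1.
rewrite (eq_bigr (fun xy : bits n * bits n => \prod_i
  (dsbs q (xy.1 i, xy.2 i) * expR (lam * phi i (xy.1 i, xy.2 i))))); last first.
  by move=> xy _; rewrite mulr_sumr expR_sum /iid big_split.
rewrite -(pair_bigA _ (fun x y : bits n => \prod_i
  (dsbs q (x i, y i) * expR (lam * phi i (x i, y i))))) /=.
rewrite (sum_ffun2_prod (fun i a b => dsbs q (a, b) * expR (lam * phi i (a, b)))).
rewrite expRM_natl.
rewrite -[X in _ ^+ X](card_ord n) -prodr_const; apply: ler_prod => i _.
rewrite (pair_bigA _ (fun a b => dsbs q (a, b) * expR (lam * phi i (a, b)))) /=.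
apply/andP; split.
  by apply: sumr_ge0 => -[a b] _; rewrite mulr_ge0 ?expR_ge0 ?dsbs_ge0.
rewrite (eq_bigr (fun ab => dsbs q ab * expR (lam * phi i ab))); last by case.
apply: mgf_le => //; first by move=> ab; exact: dsbs_ge0.
  rewrite -(pair_bigA _ (fun a b => dsbs q (a, b))) /= !sum_bool !dsbsE /sg /=.
  by field.
apply: etrans (phi0 i); rewrite pair_bigA /=.
by apply: eq_bigr => -[].
Qed.

Lemma simulated_ge0 (R : realType) (n : nat) (p : R)
    (K L : channel R (bits n) (bits n)) xy :
  0 <= p -> p <= 1 -> 0 <= simulated (dsbs p) K L xy.
Proof.
move=> p0 p1; apply: sumr_ge0 => u _; apply: sumr_ge0 => v _.
by rewrite !mulr_ge0 ?fdist_ge0 ?iid_ge0.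
Qed.

Lemma simulated_expect (R : realType) (n : nat) (pUV : bool * bool -> R)
    (K L : channel R (bits n) (bits n)) (phi : bits n * bits n -> R) :
  \sum_xy simulated pUV K L xy * phi xy =
  \sum_u \sum_v iid pUV (u, v) * \sum_x \sum_y K u x * L v y * phi (x, y).
Proof.
rewrite /simulated; under eq_bigr do rewrite mulr_suml.
rewrite exchange_big /=; apply: eq_bigr => u _.
under eq_bigr do rewrite mulr_suml.
rewrite exchange_big /=; apply: eq_bigr => v _.
rewrite pair_bigA mulr_sumr; apply: eq_bigr => -[x y] _ /=.
by rewrite !mulrA.
Qed.

Lemma simulated_expectM (R : realType) (n : nat) (p : R)
    (K L : channel R (bits n) (bits n)) (f g : bits n -> R) :
  \sum_xy simulated (dsbs p) K L xy * (f xy.1 * g xy.2) =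
  \sum_u \sum_v iid (dsbs p) (u, v) * (\sum_x K u x * f x) * (\sum_y L v y * g y).
Proof.
rewrite simulated_expect; apply: eq_bigr => u _; apply: eq_bigr => v _.
rewrite -mulrA; congr (_ * _); rewrite mulr_suml; apply: eq_bigr => x _.
by rewrite mulr_sumr; apply: eq_bigr => y _ /=; ring.
Qed.

Lemma simulated_expectl (R : realType) (n : nat) (p : R)
    (K L : channel R (bits n) (bits n)) (f : bits n -> R) :
  \sum_xy simulated (dsbs p) K L xy * f xy.1 = avg (fun u => \sum_x K u x * f x).
Proof.
transitivity (\sum_xy simulated (dsbs p) K L xy * (f xy.1 * (fun=> 1) xy.2)).
  by apply: eq_bigr => xy _; rewrite mulr1.
rewrite (simulated_expectM p K L f (fun=> 1)) /avg mulr_sumr; apply: eq_bigr => u _.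
rewrite -(iid_marginal p u) mulr_suml; apply: eq_bigr => v _.
by under [X in _ * X]eq_bigr do rewrite mulr1; rewrite fdist_sum1 mulr1.
Qed.

Lemma simulated_sum1 (R : realType) (n : nat) (p : R)
    (K L : channel R (bits n) (bits n)) :
  \sum_xy simulated (dsbs p) K L xy = 1.
Proof.
transitivity (\sum_xy simulated (dsbs p) K L xy * (fun=> 1) xy.1).
  by apply: eq_bigr => xy _; rewrite mulr1.
rewrite (simulated_expectl p K L (fun=> 1)) -[RHS](avg_const n); apply: eq_avg => u.
by under eq_bigr do rewrite mulr1; rewrite fdist_sum1.
Qed.

Lemma simulable_swap (R : realType) (n : nat) (eps p q : R)
    (K L : channel R (bits n) (bits n)) :
  simulable eps (dsbs p) (dsbs q) K L -> simulable eps (dsbs p) (dsbs q) L K.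
Proof.
have simC x y : simulated (dsbs p) L K (x, y) = simulated (dsbs p) K L (y, x).
  rewrite /simulated exchange_big /=; apply: eq_bigr => u _.
  by apply: eq_bigr => v _; rewrite iidC mulrAC.
have swapK : involutive (fun xy : bits n * bits n => (xy.2, xy.1)) by case.
rewrite /simulable /KL; case: forallP => // ac h.
case: forallP => [_|]; last first.
  by case=> -[x y]; rewrite simC iidC; exact: ac.
rewrite (reindex _ (onW_bij _ (inv_bij swapK))) /=; congr (_ <= _)%E: h.
by congr (_%:E); apply: eq_bigr => -[x y] _ /=; rewrite simC iidC.
Qed.

(** * Recovering a scalar map *)

Lemma sum_card1 (R : realType) (T : finType) (F : {set T} -> R) :
  \sum_(S : {set T} | #|S| == 1%N) F S = \sum_j F [set j]%SET.
Proof.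
rewrite (eq_bigl (mem ((@finset.set1 T) @: finset.setT))) => [|S].
  rewrite big_imset /=; first by apply: eq_bigl => j; rewrite finset.in_setT.
  by move=> i j _ _; exact: finset.set1_inj.
apply/cards1P/imsetP => [[j ->]|[j _ ->]]; first by exists j.
by exists j.
Qed.

(** Degree 0 keeps its weight, degree 1 is damped by rho and all higher degrees by at least rho^2,
    while the total weight is at most 1. Each unit missing from degree 1 thus costs rho - rho^2. *)
Lemma stability_le (R : realType) (n : nat) (f : bits n -> R) (rho : R) :
  (forall u, `|f u| <= 1) -> 0 <= rho -> rho <= 1 ->
  \sum_(S : {set 'I_n}) rho ^+ #|S| * hat f S ^+ 2 <=
  avg f ^+ 2 + rho - (rho - rho ^+ 2) * (1 - lev1 f).
Proof.
move=> f1 r0 r1; have fsq u : f u ^+ 2 <= 1.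
  by rewrite -(real_normK (num_real _)) expr_le1.
have Ef : avg (fun u => f u ^+ 2) <= 1.
  by rewrite -[leRHS](avg_const n (1 : R)); exact: avg_le.
have h0 : avg f = hat f finset.set0.
  by apply: eq_avg => u; rewrite chi0 mulr1.
apply: (@le_trans _ _ (\sum_(S : {set 'I_n}) ((if #|S| == 0%N then hat f S ^+ 2 else 0)
   + (if #|S| == 1%N then (rho - rho ^+ 2) * hat f S ^+ 2 else 0)
   + rho ^+ 2 * hat f S ^+ 2))).
  apply: ler_sum => S _; have := sqr_ge0 (hat f S).
  case: #|S| => [|[|k]] /= H.
  - by rewrite expr0 mul1r addr0 ler_wpDr // mulr_ge0 ?sqr_ge0.
  - by rewrite expr1 add0r -mulrDl subrK.
  - rewrite !add0r ler_wpM2r // (exprD rho 2 k) ler_piMr ?sqr_ge0 //.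
    exact: exprn_ile1.
rewrite !big_split /= -!big_mkcond /= -!mulr_sumr sum_card1 -/(lev1 f) -parseval.
rewrite (eq_bigl (fun S => S == finset.set0)) ?big_pred1_eq ?h0; last first.
  by move=> S; rewrite cards_eq0.
have := sqr_ge0 rho.
set F := avg _ in Ef *; move: (lev1 f) (hat _ _ ^+ 2) F Ef => L H F F1 rr.
have : rho ^+ 2 * F <= rho ^+ 2 by rewrite ler_piMr.
lra.
Qed.

Lemma iid_flip (R : realType) (p : R) (n : nat) (k : 'I_n) (u v : bits n) :
  iid (dsbs p) (flip k u, flip k v) = iid (dsbs p) (u, v).
Proof.
apply: eq_bigr => i _; rewrite !ffunE /dsbs /=.
by case: (u i) (v i) (i == k) => [] [] [].
Qed.

(** Flipping the same coordinate on both sides preserves the source law. *)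
Lemma iid_odd (R : realType) (p : R) (n : nat) (k : 'I_n)
    (F : bits n -> bits n -> R) :
  (forall u v, F (flip k u) (flip k v) = - F u v) ->
  \sum_u \sum_v iid (dsbs p) (u, v) * F u v = 0.
Proof.
move=> Fodd; set S := LHS.
suff : S = - S by move/eqP; rewrite -addr_eq0 -mulr2n mulrn_eq0 /= => /eqP.
rewrite {1}/S (reindex _ (onW_bij _ (inv_bij (flipK k)))) /= -sumrN.
apply: eq_bigr => u _; rewrite (reindex _ (onW_bij _ (inv_bij (flipK k)))) /=.
by rewrite -sumrN; apply: eq_bigr => v _; rewrite iid_flip Fodd mulrN.
Qed.

(** * Moment tests through the divergence bound *)

Definition cmean (R : realType) (n : nat) (K : channel R (bits n) (bits n))
    (i : 'I_n) (u : bits n) : R :=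
  \sum_x K u x * sg R (x i).

Lemma sg_norm (R : realType) (b : bool) : `|sg R b| = 1.
Proof. by rewrite normrX normrN normr1 expr1n. Qed.

Lemma cmean_norm (R : realType) (n : nat) (K : channel R (bits n) (bits n))
    (i : 'I_n) (u : bits n) : `|cmean K i u| <= 1.
Proof.
apply: (le_trans (ler_norm_sum _ _ _)).
rewrite (eq_bigr (K u)) ?fdist_sum1 // => x _.
by rewrite normrM sg_norm mulr1 ger0_norm // fdist_ge0.
Qed.

Lemma norm_sign (R : realType) (c : R) : sg R (c < 0) * c = `|c|.
Proof.
case: ltP => c0; rewrite /sg ?mulN1r ?mul1r; first by rewrite ltr0_norm.
by rewrite ger0_norm.
Qed.

(** With multiplier lam = eta / (2 n), the bound lam E <= eps + 2 n lam^2 reads E <= 2 n eps / eta +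
    eta, which is at most 3 eta / 2 under the hypothesis on n eps. *)
Lemma dv_bound (R : realType) (n : nat) (p q eps eta : R)
    (K L : channel R (bits n) (bits n)) (phi : bits n * bits n -> R) :
  (0 < n)%N -> 0 <= p -> p <= 1 -> 0 <= q -> q <= 1 -> 0 < eta ->
  n%:R * eps <= eta ^+ 2 / 4 ->
  simulable eps (dsbs p) (dsbs q) K L ->
  \sum_xy iid (dsbs q) xy * expR (eta / (2 * n%:R) * phi xy) <=
    expR (n%:R * (2 * (eta / (2 * n%:R)) ^+ 2)) ->
  \sum_xy simulated (dsbs p) K L xy * phi xy <= 2 * eta.
Proof.
move=> n0 p0 p1 q0 q1 eta0 heps sim hmgf.
have nR0 : 0 < n%:R :> R by rewrite ltr0n.
have := @gibbs R _ (simulated (dsbs p) K L) (iid (dsbs q) (n := n))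
  (fun xy => eta / (2 * n%:R) * phi xy) eps _ _ _ (simulated_sum1 p K L) sim hmgf.
under eq_bigr do rewrite mulrCA.
rewrite -mulr_sumr => h.
have {}h := h (fun xy => simulated_ge0 K L xy p0 p1) (fun xy => iid_ge0 xy q0 q1).
set E := \sum_xy _ in h *.
have h1 : eta * E <= eta * (2 * eta).
  have -> : eta * E = (2 * n%:R) * (eta / (2 * n%:R) * E).
    by field; rewrite gt_eqF.
  apply: (@le_trans _ _ ((2 * n%:R) * (eps + n%:R * (2 * (eta / (2 * n%:R)) ^+ 2)))).
    by rewrite ler_pM2l // mulr_gt0.
  have -> : (2 * n%:R) * (eps + n%:R * (2 * (eta / (2 * n%:R)) ^+ 2)) =
      2 * (n%:R * eps) + eta ^+ 2 by field; rewrite gt_eqF.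
  have := sqr_ge0 eta; lra.
by rewrite ler_pM2l in h1.
Qed.

Lemma lam_bounds (R : realType) (n : nat) (eta : R) :
  (0 < n)%N -> 0 < eta -> eta <= 1 ->
  0 <= eta / (2 * n%:R) /\ eta / (2 * n%:R) <= 1 / 2.
Proof.
move=> n0 e0 e1; have nR : 1 <= n%:R :> R by rewrite ler1n.
split; first by rewrite divr_ge0 ?ltW // mulr_gt0 // ltr0n.
by rewrite ler_pdivrMr ?mulr_gt0 ?ltr0n //; lra.
Qed.

(** The test function is the shortfall of the correlation from its target, halved so as to stay in
    [-1, 1]. [A] is the whole index set in [lev1_defect] and a singleton in [decode_agree]. *)
Lemma corr_lower (R : realType) (n : nat) (p q eps eta : R)
    (K L : channel R (bits n) (bits n)) (A : {set 'I_n}) :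
  (0 < n)%N -> 0 <= p -> p <= 1 -> 0 <= q -> q <= 1 / 2 -> 0 < eta -> eta <= 1 ->
  n%:R * eps <= eta ^+ 2 / 4 ->
  simulable eps (dsbs p) (dsbs q) K L ->
  #|A|%:R * (1 - 2 * q) - 4 * eta <=
  \sum_(i in A) \sum_u \sum_v iid (dsbs p) (u, v) * cmean K i u * cmean L i v.
Proof.
move=> n0 p0 p1 q0 q1 e0 e1 heps sim; have [l0 l1] := lam_bounds n0 e0 e1.
pose phi (i : 'I_n) (ab : bool * bool) : R :=
  if i \in A then ((1 - 2 * q) - sg R ab.1 * sg R ab.2) / 2 else 0.
have q2 : q <= 1 by lra.
have h : \sum_xy simulated (dsbs p) K L xy * \sum_i phi i (xy.1 i, xy.2 i) <= 2 * eta.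
  apply: (dv_bound n0 p0 p1 q0 q2 e0 heps sim); apply: mgf_iid_le => //.
    move=> i [a b]; rewrite /phi; case: ifP => _; last by rewrite normr0.
    by rewrite ler_norml /sg; case: a b => [] [] /=; lra.
  by move=> i; rewrite /phi !sum_bool !dsbsE /sg; case: ifP => _ /=; field.
have : \sum_xy simulated (dsbs p) K L xy * \sum_i phi i (xy.1 i, xy.2 i) =
  (#|A|%:R * (1 - 2 * q) - \sum_(i in A) \sum_u \sum_v
     iid (dsbs p) (u, v) * cmean K i u * cmean L i v) / 2.
  under eq_bigr do rewrite mulr_sumr.
  have -> : #|A|%:R * (1 - 2 * q) = \sum_(i in A) (1 - 2 * q).
    by rewrite sumr_const mulr_natl.
  rewrite exchange_big /= -sumrB mulr_suml [RHS]big_mkcond /=.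
  apply: eq_bigr => i _; rewrite /phi; case: ifP => _; last first.
    by rewrite big1 // => xy _; rewrite mulr0.
  rewrite -(simulated_expectM p K L (fun x => sg R (x i)) (fun x => sg R (x i))).
  transitivity ((\sum_xy simulated (dsbs p) K L xy * (1 - 2 * q) -
    \sum_xy simulated (dsbs p) K L xy * (sg R (xy.1 i) * sg R (xy.2 i))) / 2).
    by rewrite -sumrB mulr_suml; apply: eq_bigr => xy _ /=; ring.
  by rewrite -mulr_suml simulated_sum1 mul1r.
lra.
Qed.

(** Signing each coordinate by the sign of its mean makes a linear test function see the sum of the
    absolute values. *)
Lemma bias_upper (R : realType) (n : nat) (p q eps eta : R)
    (K L : channel R (bits n) (bits n)) :
  (0 < n)%N -> 0 <= p -> p <= 1 -> 0 <= q -> q <= 1 / 2 -> 0 < eta -> eta <= 1 ->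
  n%:R * eps <= eta ^+ 2 / 4 ->
  simulable eps (dsbs p) (dsbs q) K L ->
  \sum_i `|avg (cmean K i)| <= 2 * eta.
Proof.
move=> n0 p0 p1 q0 q1 e0 e1 heps sim; have [l0 l1] := lam_bounds n0 e0 e1.
pose c i := sg R (avg (cmean K i) < 0).
pose phi (i : 'I_n) (ab : bool * bool) : R := c i * sg R ab.1.
have q2 : q <= 1 by lra.
have h : \sum_xy simulated (dsbs p) K L xy * \sum_i phi i (xy.1 i, xy.2 i) <= 2 * eta.
  apply: (dv_bound n0 p0 p1 q0 q2 e0 heps sim); apply: mgf_iid_le => //.
    by move=> i [a b]; rewrite /phi normrM !sg_norm mul1r.
  by move=> i; rewrite /phi !sum_bool !dsbsE /sg /=; field.
apply: le_trans h; rewrite le_eqVlt; apply/orP; left; apply/eqP.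
rewrite /phi /=.
rewrite (@simulated_expectl _ _ p K L (fun x => \sum_i c i * sg R (x i))).
rewrite (@eq_avg _ _ _ (fun u => \sum_i c i * cmean K i u)).
  by rewrite avg_sum; apply: eq_bigr => i _; rewrite avgZ norm_sign.
move=> u; under eq_bigr do rewrite mulr_sumr.
rewrite exchange_big /=; apply: eq_bigr => i _; rewrite mulr_sumr.
by apply: eq_bigr => x _; rewrite mulrCA.
Qed.

(** Distinct coordinates are uncorrelated under the target; [c] is left free so that either sign of
    the correlation can be tested. *)
Lemma pair_upper (R : realType) (n : nat) (p q eps eta c : R)
    (K L : channel R (bits n) (bits n)) (i j : 'I_n) :
  (0 < n)%N -> 0 <= p -> p <= 1 -> 0 <= q -> q <= 1 / 2 -> 0 < eta -> eta <= 1 ->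
  n%:R * eps <= eta ^+ 2 / 4 ->
  simulable eps (dsbs p) (dsbs q) K L -> i != j -> `|c| <= 1 ->
  avg (fun u => \sum_x K u x * (c * (sg R (x i) * sg R (x j)))) <= 2 * eta.
Proof.
move=> n0 p0 p1 q0 q1 e0 e1 heps sim nij c1; have [l0 l1] := lam_bounds n0 e0 e1.
have q2 : q <= 1 by lra.
rewrite -(simulated_expectl p K L (fun x => c * (sg R (x i) * sg R (x j)))).
apply: (dv_bound n0 p0 p1 q0 q2 e0 heps sim).
(* A single bounded test function costs 2 lam^2; the factor n is added only to match [dv_bound]. *)
apply: (@le_trans _ _ (expR (2 * (eta / (2 * n%:R)) ^+ 2))); last first.
  by rewrite ler_expR ler_peMl ?ler1n // mulr_ge0 ?sqr_ge0.
apply: mgf_le => // [xy||xy|]; first exact: iid_ge0.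
- exact: iid_sum1.
- by rewrite 2!normrM !sg_norm !mulr1.
rewrite -[LHS](pair_bigA _ (fun x y => iid (dsbs q) (x, y) *
  (c * (sg R (x i) * sg R (x j))))) /=.
apply: (@iid_odd R q n i (fun x y => c * (sg R (x i) * sg R (x j)))) => u v.
by rewrite !sg_flip eqxx eq_sym (negbTE nij) mulNr mulrN.
Qed.

Lemma lev1_le1 (R : realType) (n : nat) (K : channel R (bits n) (bits n)) i :
  lev1 (cmean K i) <= 1.
Proof. by have [] := fkn i (cmean_norm K i). Qed.

Lemma avg_norm_le1 (R : realType) (n : nat) (f : bits n -> R) :
  (forall u, `|f u| <= 1) -> `|avg f| <= 1.
Proof.
move=> f1; rewrite ler_norml; apply/andP; split.
  rewrite -[leLHS](avg_const n); apply: avg_le => u.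
  by have := f1 u; rewrite ler_norml => /andP[].
rewrite -[leRHS](avg_const n); apply: avg_le => u.
by have := f1 u; rewrite ler_norml => /andP[].
Qed.

(* The noise damps degrees >= 2 by an extra factor rho, so that an almost
   maximal correlation leaves almost all the weight on degree 1. *)
Lemma lev1_defect (R : realType) (n : nat) (p delta eps eta : R)
    (K L : channel R (bits n) (bits n)) :
  (0 < n)%N -> 0 <= p -> 0 <= delta -> p + delta <= 1 / 2 ->
  0 < eta -> eta <= 1 ->
  n%:R * eps <= eta ^+ 2 / 4 -> n%:R * delta <= eta ->
  simulable eps (dsbs p) (dsbs (p + delta)) K L ->
  ((1 - 2 * p) - (1 - 2 * p) ^+ 2) * \sum_i (1 - lev1 (cmean K i)) <= 16 * eta.
Proof.
move=> n0 p0 d0 q1 e0 e1 heps hd sim; set rho := 1 - 2 * p.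
have p1 : p <= 1 by lra.
have q0 : 0 <= p + delta by lra.
have rho0 : 0 <= rho by rewrite /rho; lra.
have rho1 : rho <= 1 by rewrite /rho; lra.
have hK := bias_upper n0 p0 p1 q0 q1 e0 e1 heps sim.
have hL := bias_upper n0 p0 p1 q0 q1 e0 e1 heps (simulable_swap sim).
have := corr_lower [set: 'I_n]%SET n0 p0 p1 q0 q1 e0 e1 heps sim.
rewrite cardsT card_ord (eq_bigl predT) => [hC|i]; last by rewrite finset.in_setT.
(* Each mean is at most 1 in absolute value, so its square is at most its absolute value. *)
have bias (f : 'I_n -> bits n -> R) : (forall i u, `|f i u| <= 1) ->
    \sum_i `|avg (f i)| <= 2 * eta -> \sum_i avg (f i) ^+ 2 <= 2 * eta.
  move=> f1; apply: le_trans; apply: ler_sum => i _.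
  rewrite -(real_normK (num_real _)) expr2 ler_piMr //.
  exact: avg_norm_le1.
have {}hK := bias _ (cmean_norm K) hK; have {}hL := bias _ (cmean_norm L) hL.
have stab i : \sum_u \sum_v iid (dsbs p) (u, v) * cmean K i u * cmean L i v <=
    (avg (cmean K i) ^+ 2 + avg (cmean L i) ^+ 2) / 2 + rho -
    (rho - rho ^+ 2) / 2 * (1 - lev1 (cmean K i)).
  rewrite corr_hat -/rho.
  have := stability_le (cmean_norm K i) rho0 rho1.
  have := stability_le (cmean_norm L i) rho0 rho1.
  have : 0 <= (rho - rho ^+ 2) * (1 - lev1 (cmean L i)).
    rewrite mulr_ge0 ?subr_ge0 ?lev1_le1 //.
    by rewrite expr2 ler_piMr.
  set hk := \sum_S _ * hat (cmean K i) S ^+ 2.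
  set hl := \sum_S _ * hat (cmean L i) S ^+ 2.
  (* The inequality 2ab <= a^2 + b^2, degree by degree, separates the two sides. *)
  have : \sum_(S : {set 'I_n}) rho ^+ #|S| * hat (cmean K i) S * hat (cmean L i) S
      <= (hk + hl) / 2.
    rewrite -big_split /= mulr_suml; apply: ler_sum => S _.
    rewrite -mulrDr -[leLHS]mulrA -[leRHS]mulrA ler_wpM2l ?exprn_ge0 //.
    move: (hat (cmean K i) S) (hat (cmean L i) S) => a b.
    have := sqr_ge0 (a - b); lra.
  lra.
have : \sum_i \sum_u \sum_v iid (dsbs p) (u, v) * cmean K i u * cmean L i v <=
   (\sum_i avg (cmean K i) ^+ 2 + \sum_i avg (cmean L i) ^+ 2) / 2 + n%:R * rho
   - (rho - rho ^+ 2) / 2 * \sum_i (1 - lev1 (cmean K i)).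
  have -> : n%:R * rho = \sum_(i < n) rho.
    by rewrite sumr_const card_ord mulr_natl.
  rewrite -big_split /= mulr_suml -big_split /= mulr_sumr -sumrB.
  by apply: ler_sum => i _; exact: stab.
(* The losses are 4 eta from the correlations, 2 eta from delta and 2 eta from the squared means;
   clearing the factor 1/2 of the defect doubles their sum to 16 eta. *)
have : n%:R * (1 - 2 * (p + delta)) = n%:R * rho - 2 * (n%:R * delta).
  by rewrite /rho; ring.
lra.
Qed.

Definition miss (R : realType) (n : nat) (K : channel R (bits n) (bits n))
    (j : 'I_n -> 'I_n) (b : 'I_n -> bool) (i : 'I_n) (u : bits n) : R :=
  \sum_(x : bits n | x i != u (j i) (+) b i) K u x.

Lemma miss_ge0 (R : realType) (n : nat) (K : channel R (bits n) (bits n))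
    j b i u : 0 <= miss K j b i u.
Proof. by apply: sumr_ge0 => x _; exact: fdist_ge0. Qed.

Lemma missE (R : realType) (n : nat) (K : channel R (bits n) (bits n)) j b i u :
  miss K j b i u = (1 - sg R (b i) * (sg R (u (j i)) * cmean K i u)) / 2.
Proof.
rewrite /miss big_mkcond /= -[X in X - _](fdist_sum1 (K u)) /cmean !mulr_sumr.
rewrite -sumrB mulr_suml.
apply: eq_bigr => x _.
by case: (x i) (u (j i)) (b i) => [] [] []; rewrite /sg /=; field.
Qed.

(** Guess X_i from the dominant coefficient H of its conditional mean, with the sign of H. The guess
    fails with probability (1 - |H|) / 2, and 1 - |H| <= 1 - H^2 is at most 5200 times the degree-1
    defect; hence 2600. *)
Lemma decode (R : realType) (n : nat) (p delta eps eta : R)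
    (K L : channel R (bits n) (bits n)) :
  (0 < n)%N -> 0 < p -> p < 1 / 2 -> 0 <= delta -> p + delta <= 1 / 2 ->
  0 < eta -> eta <= 1 ->
  n%:R * eps <= eta ^+ 2 / 4 -> n%:R * delta <= eta ->
  simulable eps (dsbs p) (dsbs (p + delta)) K L ->
  exists (j : 'I_n -> 'I_n) (b : 'I_n -> bool),
    \sum_i avg (miss K j b i) <=
      2600 * 16 / ((1 - 2 * p) - (1 - 2 * p) ^+ 2) * eta.
Proof.
move=> n0 p0 p1 d0 q1 e0 e1 heps hd sim.
have h := lev1_defect n0 (ltW p0) d0 q1 e0 e1 heps hd sim.
set rho := 1 - 2 * p in h *.
have rr : 0 < rho - rho ^+ 2.
  have -> : rho - rho ^+ 2 = (2 * p) * (1 - 2 * p) by rewrite /rho; ring.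
  by rewrite mulr_gt0 //; lra.
have [j hj] := choice (fun i => (fkn i (cmean_norm K i)).2).
exists j, (fun i => hat (cmean K i) [set j i]%SET < 0).
apply: (@le_trans _ _ (\sum_i 2600 * (1 - lev1 (cmean K i)))); last first.
  rewrite -mulr_sumr mulrAC ler_pdivlMr //; lra.
apply: ler_sum => i _; pose H := hat (cmean K i) [set j i]%SET.
rewrite (@eq_avg _ _ _ (fun u => 1 / 2 + - (sg R (H < 0) / 2) *
   (cmean K i u * sg R (u (j i))))); last first.
  by move=> u; rewrite missE /= -/H; field.
rewrite avgD avg_const avgZ -hat1 -/H.
have -> : - (sg R (H < 0) / 2) * H = - `|H| / 2 by rewrite -norm_sign; field.
have := hj i; rewrite -/H -(real_normK (num_real H)).
have : `|H| <= 1.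
  rewrite /H hat1; apply: avg_norm_le1 => u.
  by rewrite normrM sg_norm mulr1; exact: cmean_norm.
have := normr_ge0 H; nra.
Qed.

(** When neither coordinate misses, both copy the same input bit and their signed product is
    [sg R (b i (+) b i')]. *)
Lemma expect_ge_miss (R : realType) (n : nat) (K : channel R (bits n) (bits n))
    j b (i i' : 'I_n) (u : bits n) : j i = j i' ->
  1 - 2 * (miss K j b i u + miss K j b i' u) <=
  \sum_x K u x * (sg R (b i (+) b i') * (sg R (x i) * sg R (x i'))).
Proof.
move=> jE; rewrite /miss big_mkcond /= [X in 2 * (_ + X)]big_mkcond /=.
rewrite -[X in X - _](fdist_sum1 (K u)) -big_split /= mulr_sumr -sumrB.
apply: ler_sum => x _; rewrite jE; have := fdist_ge0 (K u) x.
by case: (x i) (x i') (u (j i')) (b i) (b i') => [] [] [] [] []; rewrite /sg /=; lra.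
Qed.

(** Two outputs copying one input bit would be almost fully correlated, against [pair_upper]. *)
Lemma decode_inj (R : realType) (n : nat) (p q eps eta err : R)
    (K L : channel R (bits n) (bits n)) j b :
  (0 < n)%N -> 0 <= p -> p <= 1 -> 0 <= q -> q <= 1 / 2 -> 0 < eta -> eta <= 1 ->
  n%:R * eps <= eta ^+ 2 / 4 ->
  simulable eps (dsbs p) (dsbs q) K L ->
  \sum_i avg (miss K j b i) <= err -> 2 * err + 2 * eta < 1 ->
  injective j.
Proof.
move=> n0 p0 p1 q0 q1 e0 e1 heps sim herr small i i' jE.
apply/eqP/negPn/negP => nii.
have c1 : `|sg R (b i (+) b i')| <= 1 by rewrite sg_norm.
have := pair_upper n0 p0 p1 q0 q1 e0 e1 heps sim nii c1.
have := avg_le (fun u => expect_ge_miss K b u jE).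
rewrite avgD avg_const avgN avgZ avgD.
have : avg (miss K j b i) + avg (miss K j b i') <= err.
  apply: le_trans herr; rewrite (bigD1 i) //= (bigD1 i') 1?eq_sym //= addrA.
  rewrite lerDl; apply: sumr_ge0 => k _; apply: avg_ge0 => u; exact: miss_ge0.
lra.
Qed.

Lemma cmean_prod_le (R : realType) (n : nat) (K L : channel R (bits n) (bits n))
    j j' b b' (i : 'I_n) (u v : bits n) :
  cmean K i u * cmean L i v <=
  sg R (b i (+) b' i) * (sg R (u (j i)) * sg R (v (j' i))) +
  2 * (miss K j b i u + miss L j' b' i v).
Proof.
rewrite !missE sg_addb.
have := cmean_norm K i u; have := cmean_norm L i v; rewrite !ler_norml.
move: (cmean K i u) (cmean L i v) => s t /andP[t1 t2] /andP[s1 s2].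
by case: (b i) (b' i) (u (j i)) (v (j' i)) => [] [] [] []; rewrite /sg /=; nra.
Qed.

(** If X_i and Y_i copied different coordinates, U_(j i) and V_(j' i) would be uncorrelated and
    E[X_i Y_i] at most 4 err, whereas it is at least 1 - 2p - 6 eta. *)
Lemma decode_agree (R : realType) (n : nat) (p delta eps eta err : R)
    (K L : channel R (bits n) (bits n)) j j' b b' :
  (0 < n)%N -> 0 <= p -> 0 <= delta -> p + delta <= 1 / 2 -> 0 < eta -> eta <= 1 ->
  n%:R * eps <= eta ^+ 2 / 4 -> n%:R * delta <= eta ->
  simulable eps (dsbs p) (dsbs (p + delta)) K L ->
  \sum_i avg (miss K j b i) <= err -> \sum_i avg (miss L j' b' i) <= err ->
  4 * err + 6 * eta < 1 - 2 * p ->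
  j =1 j'.
Proof.
move=> n0 p0 d0 q1 e0 e1 heps hd sim hK hL small i.
apply/eqP/negPn/negP => njj.
have p1 : p <= 1 by lra.
have q0 : 0 <= p + delta by lra.
have := corr_lower [set i]%SET n0 p0 p1 q0 q1 e0 e1 heps sim.
rewrite cards1 big_set1 mul1r.
have d1 : delta <= eta.
  by apply: le_trans hd; rewrite ler_peMl // ler1n.
have one (M : channel R (bits n) (bits n)) (k : 'I_n -> 'I_n) c :
    avg (miss M k c i) <= \sum_l avg (miss M k c l).
  rewrite (bigD1 i) //= lerDl; apply: sumr_ge0 => l _; apply: avg_ge0 => u.
  exact: miss_ge0.
have := one K j b; have := one L j' b'.
have : \sum_u \sum_v iid (dsbs p) (u, v) * cmean K i u * cmean L i v <=
  2 * (avg (miss K j b i) + avg (miss L j' b' i)).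
  apply: (@le_trans _ _ (\sum_u \sum_v (iid (dsbs p) (u, v) *
     (sg R (b i (+) b' i) * (sg R (u (j i)) * sg R (v (j' i))))
     + (2 * (iid (dsbs p) (u, v) * miss K j b i u)
     + 2 * (iid (dsbs p) (u, v) * miss L j' b' i v))))).
    apply: ler_sum => u _; apply: ler_sum => v _.
    rewrite -mulrA (_ : _ + _ = iid (dsbs p) (u, v) *
      (sg R (b i (+) b' i) * (sg R (u (j i)) * sg R (v (j' i))) +
       2 * (miss K j b i u + miss L j' b' i v))); last by ring.
    by rewrite ler_wpM2l ?iid_ge0 ?cmean_prod_le.
  under eq_bigr do rewrite !big_split /=.
  rewrite !big_split /=.
  rewrite (@iid_odd R p n (j i) (fun u v => sg R (b i (+) b' i) *
    (sg R (u (j i)) * sg R (v (j' i))))); last first.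
    by move=> u v; rewrite !sg_flip eqxx eq_sym (negbTE njj) mulNr mulrN.
  rewrite add0r mulrDr le_eqVlt; apply/orP; left; apply/eqP; congr (_ + _).
    rewrite /avg mulr_sumr mulr_sumr; apply: eq_bigr => u _.
    by rewrite -(iid_marginal p u) -!mulr_sumr mulr_suml.
  rewrite exchange_big /= /avg mulr_sumr mulr_sumr; apply: eq_bigr => v _.
  by rewrite -(iid_marginalr p v) -!mulr_sumr mulr_suml.
lra.
Qed.

Lemma point_ge0 (R : realType) (T : finType) (t x : T) : 0 <= (x == t)%:R :> R.
Proof. exact: ler0n. Qed.

Lemma point_sum1 (R : realType) (T : finType) (t : T) :
  \sum_x (x == t)%:R = 1 :> R.
Proof.
by rewrite (bigD1 t) //= eqxx big1 ?addr0 // => x /negbTE ->.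
Qed.

Definition pointf (R : realType) (T : finType) (t : T) : fdist R T :=
  Fdist (@point_ge0 R T t) (@point_sum1 R T t).

Lemma dTV_point (R : realType) (T : finType) (P Q : T -> R) (t : T) :
  (forall x, 0 <= P x) -> \sum_x P x = 1 -> (forall x, Q x = (x == t)%:R) ->
  dTV P Q <= \sum_(x | x != t) P x.
Proof.
move=> P0 P1 QE; have bad0 : 0 <= \sum_(x | x != t) P x by exact: sumr_ge0.
apply: bigmax_le => // A _.
have -> : \sum_(x in A) Q x = (t \in A)%:R.
  rewrite big_mkcond /= (bigD1 t) //= big1 ?addr0; last first.
    by move=> x xt; rewrite QE (negbTE xt); case: ifP.
  by rewrite QE eqxx; case: ifP.
have [tA|tA] := boolP (t \in A).
  rewrite -P1 distrC ger0_norm; last first.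
    by rewrite subr_ge0 [leRHS](bigID (mem A)) /= lerDl sumr_ge0.
  rewrite (bigID (mem A)) /= addrAC subrr add0r.
  rewrite [leRHS](bigID (mem A)) /= ler_wpDl ?sumr_ge0 //.
  rewrite le_eqVlt; apply/orP; left; apply/eqP; apply: eq_bigl => x.
  by case: (eqVneq x t) => [->|]; rewrite ?tA.
rewrite subr0 ger0_norm ?sumr_ge0 //.
rewrite [leRHS](bigID (mem A)) /= ler_wpDr ?sumr_ge0 //.
rewrite le_eqVlt; apply/orP; left; apply/eqP; apply: eq_bigl => x.
by case: (eqVneq x t) => [->|]; rewrite ?(negbTE tA).
Qed.

Lemma perm_law_sum (R : realType) (n : nat) (s : 'S_n) (P : bits n -> R)
    (A : pred (bits n)) :
  \sum_(z | A z) perm_law s P z = \sum_(x | A (coord_perm s x)) P x.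
Proof.
rewrite [RHS](partition_big (coord_perm s) A) //=; apply: eq_bigr => z Az.
apply: eq_bigl => x; case: eqP => [->|]; last by rewrite andbF.
by rewrite Az.
Qed.

(** The scalar channels are deterministic, so their product is a point mass, and the distance to it
    is at most the probability that some coordinate misses: a union bound. Output i of the permuted
    string is X_(s i), predicted from input j (s i) = i. *)
Lemma scalar_gap_le (R : realType) (n : nat) (K : channel R (bits n) (bits n))
    (j : 'I_n -> 'I_n) (b : 'I_n -> bool) (s : 'S_n) (u : bits n) :
  (forall i, j (s i) = i) ->
  scalar_gap K s (fun i c => pointf R (c (+) b (s i))) u <= \sum_i miss K j b i u.
Proof.
move=> js; pose z0 : bits n := [ffun i => u i (+) b (s i)].
have P1 : \sum_z perm_law s (K u) z = 1.
  by rewrite perm_law_sum fdist_sum1.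
have P0 z : 0 <= perm_law s (K u) z.
  by apply: sumr_ge0 => x _; exact: fdist_ge0.
apply: (le_trans (@dTV_point _ _ _ _ z0 P0 P1 _)).
  move=> z; have [->|nz] := eqVneq z z0.
    by rewrite /prod_channel big1 // => i _; rewrite /= ffunE eqxx.
  have [i nei] : exists i, z i != z0 i.
    apply/existsP; apply: contraNT nz; rewrite negb_exists => /forallP h.
    by apply/eqP/ffunP => i; apply/eqP; move: (h i); rewrite negbK.
  by rewrite /prod_channel (bigD1 i) //=; move: nei; rewrite ffunE => /negbTE ->;
    rewrite mul0r.
rewrite (perm_law_sum _ _ (fun z => z != z0)) /miss.
rewrite big_mkcond /=; under [leRHS]eq_bigr do rewrite big_mkcond /=.
rewrite exchange_big /=; apply: ler_sum => x _.
have pos i : 0 <= (if x i != u (j i) (+) b i then K u x else 0).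
  by case: ifP => // _; exact: fdist_ge0.
case: ifP => [nz|_]; last exact: sumr_ge0.
have [i nei] : exists i, x (s i) != u i (+) b (s i).
  apply/existsP; apply: contraNT nz; rewrite negb_exists => /forallP h.
  by apply/eqP/ffunP => i; rewrite !ffunE; apply/eqP; move: (h i); rewrite negbK.
rewrite (bigD1 (s i)) //= js nei lerDl.
by apply: sumr_ge0 => k _; exact: pos.
Qed.

Lemma recover_scalar (R : realType) (n : nat) (p delta eps eta : R)
    (K L : channel R (bits n) (bits n)) :
  (0 < n)%N -> 0 < p -> p < 1 / 2 -> 0 <= delta -> p + delta <= 1 / 2 ->
  0 < eta -> eta <= 1 ->
  n%:R * eps <= eta ^+ 2 / 4 -> n%:R * delta <= eta ->
  simulable eps (dsbs p) (dsbs (p + delta)) K L ->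
  let C := 2600 * 16 / ((1 - 2 * p) - (1 - 2 * p) ^+ 2) in
  4 * (C * eta) + 6 * eta < 1 - 2 * p ->
  exists (s : 'S_n) (qX qY : 'I_n -> channel R bool bool),
    avg (scalar_gap K s qX) <= C * eta /\ avg (scalar_gap L s qY) <= C * eta.
Proof.
move=> n0 p0 p1 d0 q1 e0 e1 heps hd sim C small.
have [j [b hK]] := decode n0 p0 p1 d0 q1 e0 e1 heps hd sim.
have [j' [b' hL]] := decode n0 p0 p1 d0 q1 e0 e1 heps hd (simulable_swap sim).
have jj := decode_agree n0 (ltW p0) d0 q1 e0 e1 heps hd sim hK hL small.
have err0 : 0 <= C * eta.
  apply: le_trans hK; apply: sumr_ge0 => i _; apply: avg_ge0 => u.
  exact: miss_ge0.
have pl : p <= 1 by lra.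
have q0 : 0 <= p + delta by lra.
have hsmall : 2 * (C * eta) + 2 * eta < 1 by lra.
have jinj := decode_inj n0 (ltW p0) pl q0 q1 e0 e1 heps sim hK hsmall.
(* The inverse of the coordinate map aligns each output with the input that it copies; as [j] and
   [j'] agree, one permutation serves both sides. *)
pose s := ((perm jinj)^-1)%g.
have js i : j (s i) = i by rewrite -[RHS](permKV (perm jinj)) permE.
have js' i : j' (s i) = i by rewrite -jj js.
exists s, (fun i c => pointf R (c (+) b (s i))), (fun i c => pointf R (c (+) b' (s i))).
split.
  apply: le_trans hK; rewrite -avg_sum; apply: avg_le => u.
  exact: scalar_gap_le.
apply: le_trans hL; rewrite -avg_sum; apply: avg_le => u.
exact: scalar_gap_le.
Qed.

Lemma dTV_ge0 (R : realType) (T : finType) (P Q : T -> R) : 0 <= dTV P Q.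
Proof. exact: bigmax_ge_id. Qed.

(** * Convergence in probability *)

Lemma Pr_ge0 (R : realType) (T : finType) (P : T -> R) (E : pred T) :
  (forall t, 0 <= P t) -> 0 <= Pr P E.
Proof. by move=> P0; exact: sumr_ge0. Qed.

Lemma Pr_markov (R : realType) (T : finType) (P : T -> R) (D : T -> R) (c : R) :
  (forall t, 0 <= P t) -> (forall t, 0 <= D t) -> 0 < c ->
  Pr P (fun t => c < D t) <= (\sum_t P t * D t) / c.
Proof.
move=> P0 D0 c0; rewrite ler_pdivlMr // /Pr mulr_suml big_mkcond /=.
apply: ler_sum => t _; case: ifP => h; last by rewrite mulr_ge0.
by rewrite ler_wpM2l // ltW.
Qed.

Lemma iid_expectl (R : realType) (n : nat) (p : R) (f : bits n -> R) :
  \sum_uv iid (dsbs p) uv * f uv.1 = avg f.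
Proof.
rewrite /avg mulr_sumr -[LHS](pair_bigA _ (fun u v => iid (dsbs p) (u, v) * f u)) /=.
by apply: eq_bigr => u _; rewrite -mulr_suml iid_marginal.
Qed.

Lemma iid_expectr (R : realType) (n : nat) (p : R) (f : bits n -> R) :
  \sum_uv iid (dsbs p) uv * f uv.2 = avg f.
Proof.
rewrite /avg mulr_sumr -[LHS](pair_bigA _ (fun u v => iid (dsbs p) (u, v) * f v)) /=.
rewrite exchange_big; apply: eq_bigr => u _.
by rewrite -mulr_suml iid_marginalr.
Qed.

Lemma little_o_inv (R : realType) (a : R^nat) (e : R) :
  little_o a (fun n => 1 / n%:R) -> 0 < e ->
  \forall n \near \oo, n%:R * a n <= e.
Proof.
move=> /eqoP ha e0; have := ha e e0; apply: filterS => n.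
rewrite normrM normr1 mul1r normfV [`|n%:R|]ger0_norm ?ler0n // => h.
case: n h => [|n] h; first by rewrite mul0r ltW.
rewrite mulrC -ler_pdivlMr ?ltr0n //.
by apply: le_trans h; rewrite ler_norm.
Qed.

(** Markov's inequality; [pr] stands for either projection of the pair (U, V). *)
Lemma cvg0_in_prob_le (R : realType) (p C : R) (eta : R^nat)
    (D : forall n, bits n -> R) (pr : forall n, bits n * bits n -> bits n) :
  0 <= p -> p <= 1 -> 0 <= C ->
  (forall n u, 0 <= D n u) ->
  (forall n f, \sum_uv iid (dsbs p) uv * f (pr n uv) = avg f) ->
  (forall e, 0 < e -> \forall n \near \oo, eta n <= e) ->
  (\forall n \near \oo, avg (D n) <= C * eta n) ->
  cvg0_in_prob (dsbs p) (fun n uv => D n (pr n uv)).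
Proof.
move=> p0 p1 C0 D0 prE eta0 hD c c0; apply/cvgrPdist_le => e e0.
have ce : 0 < c * e / (C + 1) by rewrite divr_gt0 ?mulr_gt0 // ltr_wpDl.
near=> n; rewrite sub0r normrN ger0_norm; last first.
  by apply: Pr_ge0 => t; exact: iid_ge0.
apply: (le_trans (Pr_markov (fun t => iid_ge0 t p0 p1) (fun t => D0 n (pr n t)) c0)).
rewrite prE ler_pdivrMr //.
have h1 : avg (D n) <= C * eta n by near: n; exact: hD.
have h2 : eta n <= c * e / (C + 1) by near: n; exact: eta0.
apply: (le_trans h1); apply: (le_trans (ler_wpM2l C0 h2)).
rewrite mulrCA -mulrA [e * c]mulrC mulrA ler_piMr ?mulr_ge0 ?ltW //.
by rewrite ltr_pdivrMr ?ltr_wpDl // mul1r ltrDl.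
Unshelve. all: by end_near. Qed.

Lemma scalar_recovery (R : realType) (p : R) (delta epsilon : R^nat) :
  0 < p -> p < 1 / 2 ->
  (forall n, p <= p + delta n /\ p + delta n <= 1 / 2) ->
  (forall n, 0 <= epsilon n) ->
  little_o epsilon (fun n => 1 / n%:R) ->
  little_o delta (fun n => 1 / n%:R) ->
  forall K L : forall n, channel R (bits n) (bits n),
    (forall n, simulable (epsilon n) (dsbs p) (dsbs (p + delta n))
                 (K n) (L n)) ->
    exists (s : forall n, 'S_n)
           (qX qY : forall n, 'I_n -> channel R bool bool),
      cvg0_in_prob (dsbs p)
        (fun n uv => scalar_gap (K n) (s n) (qX n) uv.1) /\
      cvg0_in_prob (dsbs p)
        (fun n uv => scalar_gap (L n) (s n) (qY n) uv.2).
Proof.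
move=> p0 p2 hdelta eps0 oeps odel K L sim.
have p1 : p <= 1 by lra.
have d0 n : 0 <= delta n by have := (hdelta n).1; lra.
set rho := 1 - 2 * p; have rho0 : 0 < rho by rewrite /rho; lra.
have [C C0 rec] : exists2 C : R, 0 <= C &
    forall n (d e t : R) (K L : channel R (bits n) (bits n)),
    (0 < n)%N -> 0 <= d -> p + d <= 1 / 2 -> 0 < t -> t <= 1 ->
    n%:R * e <= t ^+ 2 / 4 -> n%:R * d <= t ->
    simulable e (dsbs p) (dsbs (p + d)) K L ->
    4 * (C * t) + 6 * t < rho ->
    exists (s : 'S_n) (qX qY : 'I_n -> channel R bool bool),
      avg (scalar_gap K s qX) <= C * t /\ avg (scalar_gap L s qY) <= C * t.
  exists (2600 * 16 / (rho - rho ^+ 2)) => [|n d e t K' L' n0].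
    apply: divr_ge0; first by apply: mulr_ge0; exact: ler0n.
    by rewrite subr_ge0 expr2; apply: ler_piMr; rewrite /rho; lra.
  exact: recover_scalar.
(* Each summand answers one demand of [recover_scalar]: n eps <= eta^2 / 4, n delta <= eta, and eta
   > 0. *)
pose eta n : R := 2 * Num.sqrt (n%:R * epsilon n) + n%:R * delta n + n.+1%:R^-1.
have na0 n : 0 <= n%:R * epsilon n by rewrite mulr_ge0.
have nd0 n : 0 <= n%:R * delta n by rewrite mulr_ge0.
have eta_gt0 n : 0 < eta n.
  by rewrite ltr_wpDl ?invr_gt0 ?ltr0n // addr_ge0 ?mulr_ge0 ?sqrtr_ge0.
have heps n : n%:R * epsilon n <= eta n ^+ 2 / 4.
  rewrite -[leLHS](sqr_sqrtr (na0 n)).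
  have -> : Num.sqrt (n%:R * epsilon n) ^+ 2 =
    (2 * Num.sqrt (n%:R * epsilon n)) ^+ 2 / 4 by field.
  have sq0 : 0 <= 2 * Num.sqrt (n%:R * epsilon n) by rewrite mulr_ge0 ?sqrtr_ge0.
  rewrite ler_pM2r ?invr_gt0 // ler_pXn2r ?nnegrE ?(ltW (eta_gt0 n)) //.
  by rewrite /eta -addrA lerDl addr_ge0.
have hdel n : n%:R * delta n <= eta n.
  by rewrite /eta addrAC lerDr addr_ge0 ?mulr_ge0 ?sqrtr_ge0.
have eta_small e : 0 < e -> \forall n \near \oo, eta n <= e.
  move=> e0; near=> n.
  have h1 : n%:R * epsilon n <= (e / 8) ^+ 2.
    near: n; apply: little_o_inv => //.
    by rewrite exprn_gt0 // divr_gt0.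
  have h2 : n%:R * delta n <= e / 4.
    by near: n; apply: little_o_inv => //; rewrite divr_gt0.
  have h3 : n.+1%:R^-1 < e / 4.
    by near: n; apply: near_infty_natSinv_lt (PosNum (divr_gt0 e0 _)).
  have h4 : Num.sqrt (n%:R * epsilon n) <= e / 8.
    have e8 : 0 <= e / 8 by rewrite divr_ge0 ?ltW.
    by rewrite -[leRHS](ger0_norm e8) -sqrtr_sqr ler_wsqrtr.
  rewrite /eta; move: (Num.sqrt _) (n%:R * delta n) (n.+1%:R^-1) h2 h3 h4.
  by move=> x y z; lra.
pose good n := [/\ (0 < n)%N, eta n <= 1 & 4 * (C * eta n) + 6 * eta n < rho].
have good_near : \forall n \near \oo, good n.
  have c0 : 0 < rho / (2 * (4 * C + 6)).
    by rewrite divr_gt0 // mulr_gt0 // ltr_wpDl // mulr_ge0.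
  near=> n; split; first by near: n; exact: nbhs_infty_gt.
    by near: n; exact: eta_small.
  have h : eta n <= rho / (2 * (4 * C + 6)) by near: n; exact: eta_small.
  have -> : 4 * (C * eta n) + 6 * eta n = (4 * C + 6) * eta n by ring.
  have C6 : 0 < 4 * C + 6 by rewrite ltr_wpDl // mulr_ge0.
  apply: (le_lt_trans (ler_wpM2l (ltW C6) h)).
  have -> : (4 * C + 6) * (rho / (2 * (4 * C + 6))) = rho / 2.
    by field; rewrite gt_eqF.
  lra.
have ex n : exists w : 'S_n * (('I_n -> channel R bool bool) *
                               ('I_n -> channel R bool bool)),
  good n -> avg (scalar_gap (K n) w.1 w.2.1) <= C * eta n /\
            avg (scalar_gap (L n) w.1 w.2.2) <= C * eta n.
  have [[n0 e1 small]|ngood] := pselect (good n); last first.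
    (* Only finitely many n are not [good]; any value will do there. *)
    by exists (1%g, (fun _ _ => pointf R true, fun _ _ => pointf R true)).
  have [s [qX [qY h]]] := rec n _ _ _ _ _ n0 (d0 n) (hdelta n).2
    (eta_gt0 n) e1 (heps n) (hdel n) (sim n) small.
  by exists (s, (qX, qY)).
pose w n := sval (cid (ex n)); have wP n := svalP (cid (ex n)).
exists (fun n => (w n).1), (fun n => (w n).2.1), (fun n => (w n).2.2); split.
  apply: (@cvg0_in_prob_le R p C eta
    (fun n => scalar_gap (K n) (w n).1 (w n).2.1) (fun n uv => uv.1)) => //.
  - exact: ltW.
  - by move=> n u; exact: dTV_ge0.
  - by move=> n f; exact: iid_expectl.
  - by apply: filterS good_near => n /wP[].
apply: (@cvg0_in_prob_le R p C eta
  (fun n => scalar_gap (L n) (w n).1 (w n).2.2) (fun n uv => uv.2)) => //.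
- exact: ltW.
- by move=> n u; exact: dTV_ge0.
- by move=> n f; exact: iid_expectr.
- by apply: filterS good_near => n /wP[].
Unshelve. all: by end_near. Qed.

(** * Additive noise channels *)

Lemma push_ge0 (R : realType) (T U : finType) (P : fdist R T) (g : T -> U) u :
  0 <= \sum_(t | g t == u) P t.
Proof. by apply: sumr_ge0 => t _; exact: fdist_ge0. Qed.

Lemma push_expect (R : realType) (T U : finType) (P : T -> R) (g : T -> U)
    (phi : U -> R) :
  \sum_u (\sum_(t | g t == u) P t) * phi u = \sum_t P t * phi (g t).
Proof.
rewrite [RHS](partition_big g predT) //=; apply: eq_bigr => u _.
by rewrite mulr_suml; apply: eq_bigr => t /eqP ->.
Qed.

Lemma push_sum1 (R : realType) (T U : finType) (P : fdist R T) (g : T -> U) :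
  \sum_u \sum_(t | g t == u) P t = 1.
Proof.
rewrite -(fdist_sum1 P); transitivity (\sum_u (\sum_(t | g t == u) P t) * 1).
  by apply: eq_bigr => u _; rewrite mulr1.
by rewrite (push_expect P g (fun=> 1)); apply: eq_bigr => t _; rewrite mulr1.
Qed.

Definition pushf (R : realType) (T U : finType) (P : fdist R T) (g : T -> U) :
  fdist R U := Fdist (push_ge0 P g) (push_sum1 P g).

Lemma prod_ge0 (R : realType) (I T : finType) (r : I -> fdist R T)
    (f : {ffun I -> T}) : 0 <= \prod_i r i (f i).
Proof. by apply: prodr_ge0 => i _; exact: fdist_ge0. Qed.

Lemma prod_sum1 (R : realType) (I T : finType) (r : I -> fdist R T) :
  \sum_(f : {ffun I -> T}) \prod_i r i (f i) = 1.
Proof. by rewrite (sum_ffun_prod (fun i => r i)) big1 // => i _; exact: fdist_sum1. Qed.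

Definition prodf (R : realType) (I T : finType) (r : I -> fdist R T) :
  fdist R {ffun I -> T} := Fdist (prod_ge0 r) (prod_sum1 r).

Lemma prodf_expect (R : realType) (I T : finType) (r : I -> fdist R T)
    (h : I -> T -> R) :
  \sum_f prodf r f * \prod_i h i (f i) = \prod_i \sum_t r i t * h i t.
Proof.
rewrite -(sum_ffun_prod (fun i t => r i t * h i t)).
by apply: eq_bigr => f _; rewrite -big_split.
Qed.

Lemma prodf_expect1 (R : realType) (I T : finType) (r : I -> fdist R T)
    (i : I) (h : T -> R) :
  \sum_f prodf r f * h (f i) = \sum_t r i t * h t.
Proof.
transitivity (\sum_f prodf r f * \prod_k (if k == i then h (f k) else 1)).
  apply: eq_bigr => f _; congr (_ * _).
  by rewrite (bigD1 i) //= eqxx big1 ?mulr1 // => k /negbTE ->.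
rewrite (prodf_expect r (fun k t => if k == i then h t else 1)).
rewrite (bigD1 i) //= eqxx [X in _ * X]big1 ?mulr1 // => k /negbTE ->.
by rewrite -[RHS](fdist_sum1 (r k)); apply: eq_bigr => t _; rewrite mulr1.
Qed.

Lemma prodf_expect2 (R : realType) (I T : finType) (r : I -> fdist R T)
    (i j : I) (h g : T -> R) : i != j ->
  \sum_f prodf r f * (h (f i) * g (f j)) =
  (\sum_t r i t * h t) * (\sum_t r j t * g t).
Proof.
move=> nij; have nji : j != i by rewrite eq_sym.
transitivity (\sum_f prodf r f * \prod_k
    (if k == i then h (f k) else if k == j then g (f k) else 1)).
  apply: eq_bigr => f _; congr (_ * _).
  rewrite (bigD1 i) //= eqxx (bigD1 j) //= eqxx (negbTE nji) big1 ?mulr1 //.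
  by move=> k /andP[/negbTE -> /negbTE ->].
rewrite (prodf_expect r (fun k t => if k == i then h t else if k == j then g t else 1)).
rewrite (bigD1 i) //= eqxx (bigD1 j) //= eqxx (negbTE nji).
rewrite [X in _ * (_ * X)]big1 ?mulr1 //.
move=> k /andP[/negbTE -> /negbTE ->].
by rewrite -[RHS](fdist_sum1 (r k)); apply: eq_bigr => t _; rewrite mulr1.
Qed.

Lemma pair_ge0 (R : realType) (T U : finType) (P : fdist R T) (Q : fdist R U)
    (w : T * U) : 0 <= P w.1 * Q w.2.
Proof. by rewrite mulr_ge0 ?fdist_ge0. Qed.

Lemma pair_sum1 (R : realType) (T U : finType) (P : fdist R T) (Q : fdist R U) :
  \sum_w P w.1 * Q w.2 = 1.
Proof.
rewrite -(pair_bigA _ (fun t u => P t * Q u)) /=.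
under eq_bigr do rewrite -mulr_sumr fdist_sum1 mulr1.
exact: fdist_sum1.
Qed.

Definition pairf (R : realType) (T U : finType) (P : fdist R T) (Q : fdist R U) :
  fdist R (T * U)%type := Fdist (pair_ge0 P Q) (pair_sum1 P Q).

Lemma xorvK (n : nat) (u : bits n) : involutive (xorv u).
Proof. by move=> x; apply/ffunP => i; rewrite !ffunE addbA addbb addFb. Qed.

Lemma xorvC (n : nat) (u v : bits n) : xorv u v = xorv v u.
Proof. by apply/ffunP => i; rewrite !ffunE addbC. Qed.

Lemma reindex_xorv (R : realType) (n : nat) (u : bits n) (F : bits n -> R) :
  \sum_x F x = \sum_x F (xorv u x).
Proof. by rewrite (reindex _ (onW_bij _ (inv_bij (xorvK u)))). Qed.

Lemma noise_ge0 (R : realType) (n : nat) (nu : fdist R (bits n)) (u x : bits n) :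
  0 <= nu (xorv u x).
Proof. exact: fdist_ge0. Qed.

Lemma noise_sum1 (R : realType) (n : nat) (nu : fdist R (bits n)) (u : bits n) :
  \sum_x nu (xorv u x) = 1.
Proof. by rewrite -(reindex_xorv u nu) fdist_sum1. Qed.

Definition noise (R : realType) (n : nat) (nu : fdist R (bits n)) :
  channel R (bits n) (bits n) := fun u => Fdist (noise_ge0 nu u) (noise_sum1 nu u).

(** The characteristic function of the noise: a sum against the law [nu], not normalized as [hat]
    is. *)
Definition cf (R : realType) (n : nat) (nu : fdist R (bits n)) (S : {set 'I_n}) : R :=
  \sum_z nu z * chi R S z.

Lemma noise_chi (R : realType) (n : nat) (nu : fdist R (bits n)) (S : {set 'I_n})
    (x : bits n) :
  \sum_u noise nu u x * chi R S u = cf nu S * chi R S x.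
Proof.
rewrite (reindex_xorv x) /cf mulr_suml; apply: eq_bigr => u _ /=.
by rewrite chi_xor [xorv (xorv _ _) _]xorvC xorvK mulrAC -mulrA [chi R S x * _]mulrC.
Qed.

Lemma simulated_noise (R : realType) (n : nat) (p : R)
    (nu mu : fdist R (bits n)) (x y : bits n) :
  simulated (dsbs p) (noise nu) (noise mu) (x, y) =
  (4 ^+ n)^-1 * \sum_(S : {set 'I_n})
    (1 - 2 * p) ^+ #|S| * (cf nu S * cf mu S) * chi R S x * chi R S y.
Proof.
rewrite /simulated.
transitivity (\sum_u \sum_v \sum_(S : {set 'I_n}) (4 ^+ n)^-1 * (1 - 2 * p) ^+ #|S| *
   (noise nu u x * chi R S u) * (noise mu v y * chi R S v)).
  apply: eq_bigr => u _; apply: eq_bigr => v _.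
  rewrite iid_chi mulr_sumr !mulr_suml.
  by apply: eq_bigr => S _; ring.
under eq_bigr => u _ do rewrite exchange_big /=.
rewrite exchange_big /= mulr_sumr; apply: eq_bigr => S _.
transitivity ((4 ^+ n)^-1 * (1 - 2 * p) ^+ #|S| * (cf nu S * chi R S x) *
   (cf mu S * chi R S y)); last by ring.
rewrite -noise_chi -noise_chi [X in _ = X * _]mulr_sumr mulr_suml; apply: eq_bigr => u _.
by rewrite mulr_sumr.
Qed.

(** The output sees only the product of the two transforms. If that product is [t ^+ #|S|], the
    transform of i.i.d. noise of bias t, the source correlation 1 - 2p becomes 1 - 2q, however the
    noise is shared between the sides. *)
Lemma noise_exact (R : realType) (n : nat) (p q t : R) (nu mu : fdist R (bits n)) xy :
  (1 - 2 * p) * t = 1 - 2 * q ->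
  (forall S, cf nu S * cf mu S = t ^+ #|S|) ->
  simulated (dsbs p) (noise nu) (noise mu) xy = iid (dsbs q) xy.
Proof.
case: xy => x y pt cfE; rewrite simulated_noise iid_chi; congr (_ * _).
by apply: eq_bigr => S _; rewrite cfE -exprMn pt.
Qed.

Lemma KL_eq0 (R : realType) (T : finType) (P Q : T -> R) :
  P =1 Q -> KL P Q = 0%E.
Proof.
move=> PQ; rewrite /KL ifT; last by apply/forallP => x; rewrite PQ implybb.
rewrite big1 // => x _; rewrite PQ; have [->|nz] := eqVneq (Q x) 0.
  by rewrite mul0r.
by rewrite divff // ln1 mulr0.
Qed.

Lemma le_dTV (R : realType) (T : finType) (P Q : T -> R) (E : pred T) :
  `|\sum_(x | E x) P x - \sum_(x | E x) Q x| <= dTV P Q.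
Proof.
have eqE F : \sum_(x | E x) F x = \sum_(x in finset E) F x :> R.
  by apply: eq_bigl => x; rewrite inE.
rewrite !eqE; exact: (le_bigmax _
  (fun A : {set T} => `|\sum_(x in A) P x - \sum_(x in A) Q x|)).
Qed.

Lemma coord_permK (n : nat) (s : 'S_n) (x : bits n) :
  coord_perm (s^-1)%g (coord_perm s x) = x.
Proof. by apply/ffunP => i; rewrite !ffunE permKV. Qed.

Lemma coord_permKV (n : nat) (s : 'S_n) (x : bits n) :
  coord_perm s (coord_perm (s^-1)%g x) = x.
Proof. by apply/ffunP => i; rewrite !ffunE permK. Qed.

(* The law of s^-1(Z) when Z has law prod_channel q u. *)
Definition unperm (R : realType) (n : nat) (s : 'S_n)
    (q : 'I_n -> channel R bool bool) (u : bits n) (k : 'I_n) : fdist R bool :=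
  q ((s^-1)%g k) (u ((s^-1)%g k)).

Lemma scalar_gap_event (R : realType) (n : nat) (K : channel R (bits n) (bits n))
    (s : 'S_n) (q : 'I_n -> channel R bool bool) (u : bits n) (E : pred (bits n)) :
  `|\sum_(x | E x) K u x - \sum_(x | E x) prodf (unperm s q u) x|
    <= scalar_gap K s q u.
Proof.
have := le_dTV (perm_law s (K u)) (prod_channel q u)
  (fun z => E (coord_perm (s^-1)%g z)).
rewrite perm_law_sum; under eq_bigl do rewrite coord_permK.
rewrite [X in _ - X](reindex (coord_perm s)) /=; last first.
  by exists (coord_perm (s^-1)%g) => x _; rewrite ?coord_permK ?coord_permKV.
under [X in _ - X]eq_bigl do rewrite coord_permK.
congr (`|_ - _| <= _); apply: eq_bigr => x _.
rewrite /prod_channel [RHS](reindex s) /=; last first.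
  by exists (s^-1)%g => i _; rewrite ?permK ?permKV.
by apply: eq_bigr => i _; rewrite ffunE /unperm permK.
Qed.

Lemma shift_ge0 (R : realType) (P : fdist R bool) (c b : bool) : 0 <= P (c (+) b).
Proof. exact: fdist_ge0. Qed.

Lemma shift_sum1 (R : realType) (P : fdist R bool) (c : bool) :
  \sum_b P (c (+) b) = 1.
Proof. by rewrite -(fdist_sum1 P) !sum_bool; case: c => //=; rewrite addrC. Qed.

Definition shiftf (R : realType) (P : fdist R bool) (c : bool) : fdist R bool :=
  Fdist (shift_ge0 P c) (shift_sum1 P c).

(** Translation by [u] turns the output law into [nu] and keeps product laws products. A distance of
    [nu] from all product laws therefore bounds the gap at every input. *)
Lemma noise_gap (R : realType) (n : nat) (nu : fdist R (bits n))
    (s : 'S_n) (q : 'I_n -> channel R bool bool) (u : bits n) :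
  exists r : 'I_n -> fdist R bool, forall E : pred (bits n),
  `|\sum_(z | E z) nu z - \sum_(z | E z) prodf r z|
    <= scalar_gap (noise nu) s q u.
Proof.
exists (fun k => shiftf (unperm s q u k) (u k)) => E.
have := scalar_gap_event (noise nu) s q u (fun x => E (xorv u x)).
rewrite (reindex (xorv u)) /=; last by exists (xorv u) => x _; rewrite xorvK.
rewrite [X in _ - X](reindex (xorv u)) /=; last first.
  by exists (xorv u) => x _; rewrite xorvK.
under eq_bigl do rewrite xorvK.
under eq_bigr do rewrite xorvK.
under [X in _ - X]eq_bigl do rewrite xorvK.
congr (`|_ - _| <= _); apply: eq_bigr => z _.
by apply: eq_bigr => k _ /=; rewrite ffunE.
Qed.

Lemma Pr_indicator (R : realType) (T : finType) (P : T -> R) (E : pred T) :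
  Pr P E = \sum_t P t * (E t)%:R.
Proof.
rewrite /Pr big_mkcond /=; apply: eq_bigr => t _.
by case: (E t); rewrite ?mulr1 ?mulr0.
Qed.

Lemma ex_bern (R : realType) (t : R) : `|t| <= 1 ->
  exists P : fdist R bool, forall b, P b = (1 + t * sg R b) / 2.
Proof.
rewrite ler_norml => /andP[t1 t2].
have P0 b : 0 <= (1 + t * sg R b) / 2 by case: b; rewrite /sg /=; lra.
have P1 : \sum_b (1 + t * sg R b) / 2 = 1 by rewrite sum_bool /sg /=; field.
by exists (Fdist P0 P1).
Qed.

Lemma cf_prodf (R : realType) (n : nat) (t : 'I_n -> R) (r : 'I_n -> fdist R bool) S :
  (forall k b, r k b = (1 + t k * sg R b) / 2) ->
  cf (prodf r) S = \prod_(k in S) t k.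
Proof.
move=> rE; transitivity (\sum_f prodf r f * \prod_k (if k \in S then sg R (f k) else 1)).
  by apply: eq_bigr => f _; rewrite chi_if.
rewrite (prodf_expect r (fun k b => if k \in S then sg R b else 1)).
rewrite [RHS]big_mkcond /=; apply: eq_bigr => k _.
by rewrite sum_bool !rE /sg /=; case: ifP => _; field.
Qed.

(** * Nonscalar simulations *)

(** The average of the indicator is the probability, under a uniform input, that the gap is at least
    1/200. The value 1/200 is small enough for all the constructions below; [exclusion_test] is the
    tightest. *)
Definition nonscalar (R : realType) (n : nat) (K : channel R (bits n) (bits n)) :=
  forall (s : 'S_n) (q : 'I_n -> channel R bool bool),
    1 / 2 <= avg (fun u => (1 / 200 <= scalar_gap K s q u)%R%:R : R).

Lemma ex_berns (R : realType) (I : finType) (t : I -> R) : (forall k, `|t k| <= 1) ->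
  exists r : I -> fdist R bool, forall k b, r k b = (1 + t k * sg R b) / 2.
Proof. by move=> t1; have [r rE] := choice (fun k => ex_bern (t1 k)); exists r. Qed.

(** Each coordinate is noised by one side alone: by [r'] on [H] and by [r] off [H]. A side is left
    clean where the other acts, which makes room there for a nonscalar pattern. *)
Lemma ex_split_noise (R : realType) (n : nat) (H : {set 'I_n}) (t : R) : `|t| <= 1 ->
  exists r r' : 'I_n -> fdist R bool,
  [/\ forall k, k \in H -> r k true = 0, forall k, k \notin H -> r' k true = 0,
      forall S, cf (prodf r) S = \prod_(k in S) (if k \in H then 1 else t)
    & forall S, cf (prodf r) S * cf (prodf r') S = t ^+ #|S|].
Proof.
move=> t1.
have tH (b : bool) : `|if b then 1 else t| <= 1 by case: b; rewrite ?normr1.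
have tH' (b : bool) : `|if b then t else 1| <= 1 by case: b; rewrite ?normr1.
have [r rE] := ex_berns (fun k : 'I_n => tH (k \in H)).
have [r' rE'] := ex_berns (fun k : 'I_n => tH' (k \in H)).
exists r, r'; split.
- by move=> k kH; rewrite rE kH mul1r subrr mul0r.
- by move=> k kH; rewrite rE' (negbTE kH) mul1r subrr mul0r.
- by move=> S; rewrite (cf_prodf S rE).
- move=> S; rewrite (cf_prodf S rE) (cf_prodf S rE') -big_split /= -prodr_const.
  by apply: eq_bigr => k _; case: ifP; rewrite ?mul1r ?mulr1.
Qed.

(** Output bit k depends on two input bits, but a scalar channel reads a single one. Flipping the
    other reverses the required output without changing the scalar law, so one of the two inputs has
    a gap of at least 1/2. *)
Lemma clean_nonscalar (R : realType) (n : nat) (K : channel R (bits n) (bits n))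
    (k l : 'I_n) : k != l ->
  (forall u x : bits n, x k != u k (+) u l -> K u x = 0) -> nonscalar K.
Proof.
move=> nkl Kclean s q; set j := (s^-1)%g k.
(* The scalar channel behind output k reads input j; [i] is one of k and l that differs from j. *)
pose i := if j == k then l else k.
have ij : j == i = false by rewrite /i; case: (eqVneq j k) => [->|/negbTE]//; exact: negbTE.
have ik u : flip i u k (+) flip i u l = ~~ (u k (+) u l).
  rewrite !ffunE /i; case: (j == k); rewrite eqxx.
    by rewrite (negbTE nkl) addbF addbT addbN.
  by rewrite eq_sym (negbTE nkl) addbF addbT addNb.
have gap u : 1 - unperm s q u k (u k (+) u l) <= scalar_gap K s q u.
  have := scalar_gap_event K s q u (fun x => x k == u k (+) u l).
  have -> : \sum_(x : bits n | x k == u k (+) u l) K u x = 1.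
    rewrite -[RHS](fdist_sum1 (K u)) [RHS](bigID (fun x : bits n => x k == u k (+) u l)) /=.
    by rewrite [X in _ = _ + X]big1 ?addr0 // => x /Kclean.
  have -> : \sum_(x : bits n | x k == u k (+) u l) prodf (unperm s q u) x =
      unperm s q u k (u k (+) u l).
    rewrite big_mkcond /=.
    transitivity (\sum_x prodf (unperm s q u) x * (x k == u k (+) u l)%:R).
      by apply: eq_bigr => x _; case: eqP; rewrite ?mulr1 ?mulr0.
    rewrite (prodf_expect1 (unperm s q u) k (fun b => (b == u k (+) u l)%:R)).
    rewrite (bigD1 (u k (+) u l)) //= eqxx mulr1 big1 ?addr0 // => b /negbTE ->.
    by rewrite mulr0.
  by apply: le_trans; rewrite ler_norm.
have law u : unperm s q (flip i u) k = unperm s q u k.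
  by rewrite /unperm -/j ffunE ij addbF.
set D := fun u => _ : R; have both u : 1 <= D u + D (flip i u).
  rewrite /D; have := gap u; have := gap (flip i u); rewrite law ik.
  have := fdist_sum1 (unperm s q u k); rewrite sum_bool => tot.
  have : unperm s q u k (~~ (u k (+) u l)) + unperm s q u k (u k (+) u l) = 1.
    by rewrite -tot; case: (_ (+) _) => //=; rewrite addrC.
  case: (leP (1 / 200) (scalar_gap K s q u)) => // h1; first by rewrite lerDl.
  by case: (leP (1 / 200) (scalar_gap K s q (flip i u))) => h2 /=; lra.
have : avg (fun _ : bits n => 1) <= avg (fun u => D u + D (flip i u)) by exact: avg_le.
by rewrite avg_const avgD avg_flip; lra.
Qed.

Lemma ord3 (n : nat) : (2 < n)%N ->
  exists i0 i1 i2 : 'I_n, [/\ i0 != i1, i0 != i2 & i1 != i2].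
Proof.
move=> n2; have n1 : (1 < n)%N by exact: ltn_trans n2.
have n0 : (0 < n)%N by exact: ltn_trans n1.
by exists (Ordinal n0), (Ordinal n1), (Ordinal n2).
Qed.

Lemma simulated_relabel (R : realType) (n : nat) (pi : bits n -> bits n)
    (K L : channel R (bits n) (bits n)) xy :
  injective pi ->
  simulated (dsbs 0) (fun u => K (pi u)) (fun v => L (pi v)) xy =
  simulated (dsbs 0) K L xy.
Proof.
move=> pinj; have pbij := injF_bij pinj.
rewrite /simulated [RHS](reindex _ (onW_bij _ pbij)) /=; apply: eq_bigr => u _.
rewrite [RHS](reindex _ (onW_bij _ pbij)) /=; apply: eq_bigr => v _.
by rewrite !iid_dsbs0 (inj_eq pinj).
Qed.

Lemma noise_clean (R : realType) (n : nat) (r : 'I_n -> fdist R bool) (k : 'I_n)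
    (u x : bits n) :
  r k true = 0 -> x k != u k -> noise (prodf r) u x = 0.
Proof.
move=> rk nxu /=; rewrite (bigD1 k) //= ffunE.
by move: nxu; case: (x k) (u k) => [] []; rewrite //= rk mul0r.
Qed.

(* With U = V, any bijection of the inputs is undetectable in the output. *)
Lemma nonscalar_noiseless (R : realType) (n : nat) (q t : R) :
  (2 < n)%N -> `|t| <= 1 -> (1 - 2 * 0) * t = 1 - 2 * q ->
  exists K L : channel R (bits n) (bits n),
    [/\ forall xy, simulated (dsbs 0) K L xy = iid (dsbs q) xy,
        nonscalar K & nonscalar L].
Proof.
move=> n2 t1 tq; have [i0 [i1 [i2 [n01 n02 n12]]]] := ord3 n2.
have [r [r' [r0 r1 _ cfE]]] := ex_split_noise [set i0]%SET t1.
(* Adding bit i2 to bits i0 and i1 is an involution, as i2 itself is unchanged. Bit i0 exposes K,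
   whose noise spares it, and bit i1 exposes L. *)
pose pi (u : bits n) : bits n := [ffun i => u i (+) (u i2 && ((i == i0) || (i == i1)))].
have piK : involutive pi.
  move=> u; apply/ffunP => i; rewrite !ffunE.
  rewrite [i2 == i0]eq_sym (negbTE n02) [i2 == i1]eq_sym (negbTE n12) andbF addbF.
  by rewrite -addbA addbb addbF.
exists (fun u => noise (prodf r) (pi u)), (fun v => noise (prodf r') (pi v)); split.
- move=> xy; rewrite (simulated_relabel (noise (prodf r)) (noise (prodf r')));
    last exact: inv_inj.
  exact: (noise_exact _ tq cfE).
- apply: (clean_nonscalar n02) => u x h; apply: (@noise_clean _ _ _ i0).
    by apply: r0; rewrite finset.in_set1.
  by rewrite ffunE eqxx andbT.
- apply: (clean_nonscalar n12) => u x h; apply: (@noise_clean _ _ _ i1).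
    by apply: r1; rewrite finset.in_set1 eq_sym.
  by rewrite ffunE eqxx orbT andbT.
Qed.

(** * Paired noise, for large delta *)

Lemma lower_tail (R : realType) (T I : finType) (P : fdist R T) (A : {set I})
    (Z : I -> pred T) (e : I -> R) :
  (forall i, i \in A -> \sum_t P t * (Z i t)%:R = e i) ->
  (forall i j, i \in A -> j \in A -> i != j ->
     \sum_t P t * ((Z i t)%:R * (Z j t)%:R) = e i * e j) ->
  0 < \sum_(i in A) e i ->
  \sum_(t | \sum_(i in A) (Z i t)%:R <= (\sum_(i in A) e i) / 2) P t <=
    4 / \sum_(i in A) e i.
Proof.
set S := \sum_(i in A) e i; pose F t : R := \sum_(i in A) (Z i t)%:R.
move=> mean cov S0.
have EF : \sum_t P t * F t = S.
  rewrite /F; under eq_bigr do rewrite mulr_sumr.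
  by rewrite exchange_big /=; apply: eq_bigr => i iA; exact: mean.
(* Uncorrelated indicators: the diagonal contributes S and the rest at most S^2, so the variance is
   at most S and Chebyshev at distance S / 2 gives 4 / S. *)
have EF2 : \sum_t P t * F t ^+ 2 <= S + S ^+ 2.
  have -> : \sum_t P t * F t ^+ 2 =
      \sum_(i in A) \sum_(j in A) \sum_t P t * ((Z i t)%:R * (Z j t)%:R).
    transitivity (\sum_t \sum_(i in A) \sum_(j in A) P t * ((Z i t)%:R * (Z j t)%:R)).
      apply: eq_bigr => t _; rewrite expr2 /F mulr_suml mulr_sumr.
      by apply: eq_bigr => i _; rewrite !mulr_sumr.
    by rewrite exchange_big /=; apply: eq_bigr => i _; rewrite exchange_big.
  rewrite expr2 {2}/S mulr_suml -big_split /=; apply: ler_sum => i iA.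
  rewrite (bigD1 i) //=; apply: lerD.
    rewrite -(mean i iA); apply: ler_sum => t _.
    by case: (Z i t); rewrite ?mulr1 ?mulr0.
  have -> : S = e i + \sum_(j in A | j != i) e j by rewrite /S (bigD1 i).
  rewrite mulrDr mulr_sumr ler_wpDl -?expr2 ?sqr_ge0 //.
  by apply: ler_sum => j /andP[jA ji]; rewrite cov // eq_sym.
clearbody S.
have var : \sum_t P t * (F t - S) ^+ 2 <= S.
  have -> : \sum_t P t * (F t - S) ^+ 2 =
     \sum_t P t * F t ^+ 2 - 2 * S * (\sum_t P t * F t) + S ^+ 2 * \sum_t P t.
    rewrite !mulr_sumr -sumrB -big_split /=; apply: eq_bigr => t _; ring.
  rewrite EF fdist_sum1; lra.
have h : (\sum_(t | F t <= S / 2) P t) * (S ^+ 2 / 4) <= S.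
  apply: le_trans var; rewrite mulr_suml big_mkcond /=; apply: ler_sum => t _.
  case: ifP => [Ft|_]; last by rewrite mulr_ge0 ?fdist_ge0 ?sqr_ge0.
  rewrite ler_wpM2l ?fdist_ge0 //.
  have -> : S ^+ 2 / 4 = (S / 2) ^+ 2 by field.
  have h1 : 0 <= S / 2 by lra.
  have h2 : S / 2 <= S - F t by lra.
  by rewrite -[leRHS]sqrrN opprB ler_pXn2r ?nnegrE // (le_trans h1).
rewrite ler_pdivlMr // -(@ler_pM2r _ S) //.
move: h; rewrite -/F; set X := \sum_(t | _) _; rewrite expr2; nra.
Qed.

(** Coordinates are paired by reversal: for [k < rev_ord k] the entry [W k] holds both bits of the
    pair, and a middle coordinate, its own mirror, takes the first bit of its entry. Independent
    entries then give independent pairs. *)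
Definition pairmap (n : nat) (W : {ffun 'I_n -> bool * bool}) : bits n :=
  [ffun k : 'I_n => if (k <= rev_ord k)%N then (W k).1 else (W (rev_ord k)).2].

(** Each pair is charged to its smaller index, so that products over coordinates and over pairs can
    be compared factor by factor. *)
Lemma prod_rev_ord (R : realType) (n : nat) (h : 'I_n -> R) :
  \prod_k h k = \prod_(k < n) (if (k < rev_ord k)%N then h k * h (rev_ord k)
                         else if k == rev_ord k then h k else 1).
Proof.
rewrite [LHS](bigID (fun k : 'I_n => (k < rev_ord k)%N)) /=.
rewrite [X in _ * X](bigID (fun k : 'I_n => k == rev_ord k)) /=.
rewrite [X in _ * (_ * X)](reindex_inj rev_ord_inj) /=.
rewrite [RHS](bigID (fun k : 'I_n => (k < rev_ord k)%N)) /=.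
rewrite [X in _ = _ * X](bigID (fun k : 'I_n => k == rev_ord k)) /=.
rewrite [X in _ = _ * (_ * X)]big1; last first.
  by move=> k /andP[/negbTE -> /negbTE ->].
rewrite [X in _ = X * _](eq_bigr (fun k => h k * h (rev_ord k))); last first.
  by move=> k ->.
rewrite big_split /= mulr1 mulrAC -mulrA; congr (_ * (_ * _)).
  by apply: eq_bigr => k /andP[/negbTE -> ->].
apply: eq_bigl => k; rewrite rev_ordK -val_eqE /=.
by have := ltn_ord k; case: (ltnP k (n - k.+1)); case: (ltnP (n - k.+1) k);
  case: eqP => //=; lia.
Qed.

(** The law of two exchangeable bits with transform [f1] at either singleton and [f12] at the
    pair. *)
Definition pair_pmf (R : realType) (f1 f12 : R) (b : bool * bool) : R :=
  (1 + f1 * (sg R b.1 + sg R b.2) + f12 * (sg R b.1 * sg R b.2)) / 4.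

Lemma sum_bool2 (R : realType) (f : bool * bool -> R) :
  \sum_b f b = f (true, true) + f (true, false) + (f (false, true) + f (false, false)).
Proof.
transitivity (\sum_a \sum_b f (a, b)).
  by rewrite pair_bigA; apply: eq_bigr => -[].
by rewrite !sum_bool.
Qed.

Lemma ex_pair_law (R : realType) (f1 f12 : R) :
  0 <= 1 + 2 * f1 + f12 -> 0 <= 1 - f12 -> 0 <= 1 - 2 * f1 + f12 ->
  exists P : fdist R (bool * bool)%type, forall b, P b = pair_pmf f1 f12 b.
Proof.
move=> h1 h2 h3.
have P0 b : 0 <= pair_pmf f1 f12 b.
  by case: b => [] [] []; rewrite /pair_pmf /sg /=; lra.
have P1 : \sum_b pair_pmf f1 f12 b = 1.
  by rewrite sum_bool2 /pair_pmf /sg /=; field.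
by exists (Fdist P0 P1).
Qed.

Definition pair_cf (R : realType) (f1 f12 : R) (a b : bool) : R :=
  if a then if b then f12 else f1 else if b then f1 else 1.

Lemma cf_pairmap (R : realType) (n : nat) (r : 'I_n -> fdist R (bool * bool)%type)
    (f1 f12 : 'I_n -> R) (S : {set 'I_n}) :
  (forall k b, r k b = pair_pmf (f1 k) (f12 k) b) ->
  cf (pushf (prodf r) (@pairmap n)) S =
  \prod_(k < n) (if (k < rev_ord k)%N
     then pair_cf (f1 k) (f12 k) (k \in S) (rev_ord k \in S)
     else if k == rev_ord k then pair_cf (f1 k) (f12 k) (k \in S) false else 1).
Proof.
move=> rE; rewrite /cf push_expect.
transitivity (\sum_W prodf r W * \prod_(k < n) (if (k < rev_ord k)%N
   then (if k \in S then sg R (W k).1 else 1) *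
        (if rev_ord k \in S then sg R (W k).2 else 1)
   else if k == rev_ord k then (if k \in S then sg R (W k).1 else 1) else 1)).
  apply: eq_bigr => W _; congr (_ * _); rewrite chi_if prod_rev_ord.
  apply: eq_bigr => k _; case: ifP => [lt|_].
    by rewrite !ffunE (ltnW lt) rev_ordK leqNgt lt.
  by case: eqP => [e|//]; rewrite !ffunE -e leqnn.
rewrite (prodf_expect r (fun k c => if (k < rev_ord k)%N
   then (if k \in S then sg R c.1 else 1) * (if rev_ord k \in S then sg R c.2 else 1)
   else if k == rev_ord k then (if k \in S then sg R c.1 else 1) else 1)).
apply: eq_bigr => k _; rewrite sum_bool2 !rE /pair_cf /pair_pmf /sg /=.
by do 4?case: ifP => _; field.
Qed.

Lemma pair_expect (R : realType) (n : nat) (r : 'I_n -> fdist R (bool * bool)%type)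
    (phi : bits n -> R) :
  \sum_z pushf (prodf r) (@pairmap n) z * phi z =
  \sum_W prodf r W * phi (pairmap W).
Proof. exact: push_expect. Qed.

Lemma pairmap_lt (n : nat) (W : {ffun 'I_n -> bool * bool}) (k : 'I_n) :
  (k < rev_ord k)%N ->
  pairmap W k = (W k).1 /\ pairmap W (rev_ord k) = (W k).2.
Proof. by move=> lt; rewrite !ffunE (ltnW lt) rev_ordK leqNgt lt. Qed.

(* [nu] puts no mass on (1,1) in any of the pairs {i, rev i}, i in A, while each
   coordinate has mean al.  A product law must either meet some (1,1) or have,
   in each pair, a coordinate so rarely 1 that their total is too small. *)
Lemma pair_test (R : realType) (n : nat) (r : 'I_n -> fdist R (bool * bool)%type)
    (A : {set 'I_n}) (al : R) (Q : 'I_n -> fdist R bool) :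
  0 < al -> al <= 1 ->
  (forall i, i \in A -> (i < rev_ord i)%N) ->
  (forall i b, i \in A -> r i b = pair_pmf (1 - 2 * al) (1 - 4 * al) b) ->
  512 <= #|A|%:R * al ^+ 2 ->
  exists E : pred (bits n),
    1 / 200 <= `|\sum_(z | E z) pushf (prodf r) (@pairmap n) z
                 - \sum_(z | E z) prodf Q z|.
Proof.
move=> al0 al1 Alt rA big; set nu := pushf _ _; set m : R := #|A|%:R in big *.
have m0 : 0 < m.
  have : m != 0 by apply: contraTneq big => ->; rewrite mul0r -ltNge.
  by rewrite lt_neqAle eq_sym ler0n andbT.
have mal : 512 <= m * al.
  by apply: (le_trans big); rewrite expr2 mulrA ler_piMr // mulr_ge0 // ltW.
pose g i := Q i true * Q (rev_ord i) true.
have Q01 k b : 0 <= Q k b <= 1.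
  rewrite fdist_ge0 -(fdist_sum1 (Q k)) (bigD1 b) //= lerDl.
  by apply: sumr_ge0 => c _; exact: fdist_ge0.
have Q0 k : 0 <= Q k true by case/andP: (Q01 k true).
have Qmean k : \sum_t Q k t * t%:R = Q k true by rewrite sum_bool /= mulr1 mulr0 addr0.
have revne i : i \in A -> i != rev_ord i.
  by move=> /Alt lt; apply/eqP => e; move: lt; rewrite -e ltnn.
have neq i j : i \in A -> j \in A -> i != j ->
    [/\ i != rev_ord j, rev_ord i != j & rev_ord i != rev_ord j].
  move=> /Alt hi /Alt hj nij; split.
  - apply/eqP => e; move: hi hj; rewrite e rev_ordK => h1 h2.
    by have := ltn_trans h1 h2; rewrite ltnn.
  - apply/eqP => e; move: hi hj; rewrite -e rev_ordK => h1 h2.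
    by have := ltn_trans h1 h2; rewrite ltnn.
  - by rewrite (inj_eq rev_ord_inj).
(* Under Q the expected number of (1,1) pairs is the sum of the [g i]. If it is at least 8, Q avoids
   them all with probability at most 4/8, while [nu] always does. *)
have [gbig|gsmall] := lerP 8 (\sum_(i in A) g i).
  exists (fun z => [forall i in A, ~~ (z i && z (rev_ord i))]).
  have nu1 : \sum_(z : bits n | [forall i in A, ~~ (z i && z (rev_ord i))]) nu z = 1.
    have nz i : i \in A -> \sum_z nu z * (z i && z (rev_ord i))%:R = 0.
      move=> iA; have lt := Alt i iA.
      rewrite (pair_expect r (fun z => (z i && z (rev_ord i))%:R)).
      transitivity (\sum_W prodf r W * (fun c => (c.1 && c.2)%:R) (W i)).
        by apply: eq_bigr => W _; have [-> ->] := pairmap_lt W lt.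
      rewrite (prodf_expect1 r i (fun c => (c.1 && c.2)%:R)) sum_bool2 !rA //.
      by rewrite /pair_pmf /sg /=; field.
    rewrite -[RHS](fdist_sum1 nu).
    rewrite [RHS](bigID (fun z : bits n => [forall i in A, ~~ (z i && z (rev_ord i))])) /=.
    rewrite [X in _ = _ + X]big1 ?addr0 // => z.
    rewrite negb_forall => /existsP[i]; rewrite negb_imply negbK => /andP[iA zi].
    have := nz i iA => /eqP; rewrite psumr_eq0; last first.
      by move=> x _; rewrite mulr_ge0 ?fdist_ge0.
    by move=> /allP /(_ z (mem_index_enum _)); rewrite zi mulr1 => /eqP.
  have S0 : 0 < \sum_(i in A) g i by lra.
  have tail : \sum_(z : bits n | \sum_(i in A) (z i && z (rev_ord i))%:R <=
      (\sum_(i in A) g i) / 2) prodf Q z <= 4 / \sum_(i in A) g i.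
    apply: (@lower_tail R _ _ (prodf Q) A (fun i z => z i && z (rev_ord i))) =>
      // [i iA|i j iA jA nij].
      under eq_bigr do rewrite -mulnb natrM.
      rewrite (prodf_expect2 Q (fun b => b%:R) (fun b => b%:R) (revne i iA)).
      by rewrite !Qmean.
    have [n1 n2 n3] := neq i j iA jA nij.
    pose h k (b : bool) : R :=
      if k \in [:: i; rev_ord i; j; rev_ord j] then b%:R else 1.
    transitivity (\sum_z prodf Q z * \prod_k h k (z k)).
      apply: eq_bigr => z _; congr (_ * _).
      rewrite (bigD1 i) //= (bigD1 (rev_ord i)) /=; last by rewrite eq_sym revne.
      rewrite (bigD1 j) /=; last by rewrite eq_sym nij eq_sym n2.
      rewrite (bigD1 (rev_ord j)) /=; last first.
        by rewrite eq_sym n1 eq_sym n3 eq_sym revne.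
      rewrite big1 => [|k /andP[/andP[/andP[k1 k2] k3] k4]]; last first.
        by rewrite /h !inE (negbTE k1) (negbTE k2) (negbTE k3) (negbTE k4).
      by rewrite /h !inE !eqxx !orbT -!mulnb !natrM /= mulr1 !mulrA.
    rewrite (prodf_expect Q h).
    rewrite (bigD1 i) //= (bigD1 (rev_ord i)) /=; last by rewrite eq_sym revne.
    rewrite (bigD1 j) /=; last by rewrite eq_sym nij eq_sym n2.
    rewrite (bigD1 (rev_ord j)) /=; last first.
      by rewrite eq_sym n1 eq_sym n3 eq_sym revne.
    rewrite [X in _ * (_ * (_ * (_ * X)))]big1 =>
      [|k /andP[/andP[/andP[k1 k2] k3] k4]]; last first.
      rewrite -[RHS](fdist_sum1 (Q k)); apply: eq_bigr => b _.
      by rewrite /h !inE (negbTE k1) (negbTE k2) (negbTE k3) (negbTE k4) mulr1.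
    by rewrite /h !inE !eqxx !orbT /= !Qmean /g mulr1 !mulrA.
  rewrite nu1.
  have : \sum_(z : bits n | [forall i in A, ~~ (z i && z (rev_ord i))]) prodf Q z <= 1 / 2.
    apply: (@le_trans _ _ (4 / \sum_(i in A) g i)); last first.
      by rewrite ler_pdivrMr //; lra.
    apply: le_trans tail; rewrite big_mkcond [leRHS]big_mkcond /=.
    apply: ler_sum => z _; case: ifP => [/forallP none|_]; last first.
      by case: ifP => // _; exact: prod_ge0.
    have -> : \sum_(i in A) (z i && z (rev_ord i))%:R = 0 :> R.
      by apply: big1 => i iA; have := none i; rewrite iA /= => /negbTE ->.
    by rewrite ifT // divr_ge0 // ltW.
  move=> h; apply: le_trans (ler_norm _); lra.
(* The coordinate of the pair that is less often 1 under Q. Counting ones at the [c i] separates the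
   laws: the mean is m al under [nu] but at most m al / 8 under Q. *)
pose c i := if Q i true <= Q (rev_ord i) true then i else rev_ord i.
have cQ i : Q (c i) true ^+ 2 <= g i.
  rewrite /c /g expr2; have [h|h] := leP (Q i true) (Q (rev_ord i) true).
    by rewrite ler_wpM2l.
  by rewrite ler_wpM2r // ltW.
pose F (z : bits n) : R := \sum_(i in A) (z (c i))%:R.
exists (fun z => F z <= (\sum_(i in A) al) / 2).
have sal : \sum_(i in A) al = m * al by rewrite sumr_const mulr_natl.
have nuF : \sum_(z | F z <= (\sum_(i in A) al) / 2) nu z <= 1 / 100.
  have S0 : 0 < \sum_(i in A) al by rewrite sal mulr_gt0.
  pose sel i (b : bool * bool) := if Q i true <= Q (rev_ord i) true then b.1 else b.2.
  have selE i W : i \in A -> pairmap W (c i) = sel i (W i).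
    by move=> /Alt lt; rewrite /c /sel; have [h1 h2] := pairmap_lt W lt; case: leP.
  have mean i : i \in A -> \sum_b r i b * (sel i b)%:R = al.
    move=> iA; rewrite sum_bool2 !rA // /sel /pair_pmf /sg.
    by case: leP => _ /=; field.
  apply: (@le_trans _ _ (4 / \sum_(i in A) al)); last first.
    by rewrite ler_pdivrMr // sal; lra.
  apply: (@lower_tail R _ _ nu A (fun i z => z (c i)) (fun=> al)) =>
    // [i iA|i j iA jA nij].
    rewrite (pair_expect r (fun z => (z (c i))%:R)) -[RHS](mean i iA).
    rewrite -(prodf_expect1 r i (fun b => (sel i b)%:R)).
    by apply: eq_bigr => W _; rewrite selE.
  rewrite (pair_expect r (fun z => (z (c i))%:R * (z (c j))%:R)).
  transitivity ((\sum_b r i b * (sel i b)%:R) * (\sum_b r j b * (sel j b)%:R));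
    last by rewrite !mean.
  rewrite -(prodf_expect2 r (fun b => (sel i b)%:R) (fun b => (sel j b)%:R) nij).
  by apply: eq_bigr => W _; rewrite !selE.
have QF : 1 / 2 <= \sum_(z | F z <= (\sum_(i in A) al) / 2) prodf Q z.
  have EF : \sum_z prodf Q z * F z = \sum_(i in A) Q (c i) true.
    rewrite /F; under eq_bigr do rewrite mulr_sumr.
    rewrite exchange_big /=; apply: eq_bigr => i _.
    by rewrite (prodf_expect1 Q (c i) (fun b => b%:R)) Qmean.
  have Eup : \sum_(i in A) Q (c i) true <= m * al / 8.
    (* A tangent bound for the square at al / 8. Summed over A it gives 32 / al + m al / 16, and 512
       <= m al^2 is what makes this at most m al / 8. *)
    have am i : Q (c i) true <= 4 / al * g i + al / 16.
      apply: (@le_trans _ _ (4 / al * Q (c i) true ^+ 2 + al / 16)); last first.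
        by rewrite lerD2r ler_wpM2l // divr_ge0 ?ltW.
      rewrite -subr_ge0.
      have -> : 4 / al * Q (c i) true ^+ 2 + al / 16 - Q (c i) true =
         4 / al * (Q (c i) true - al / 8) ^+ 2 by field; rewrite gt_eqF.
      by rewrite mulr_ge0 ?sqr_ge0 // divr_ge0 ?ltW.
    apply: (@le_trans _ _ (4 / al * (\sum_(i in A) g i) + m * (al / 16))).
      have -> : m * (al / 16) = \sum_(i in A) (al / 16).
        by rewrite sumr_const -[RHS]mulr_natl.
      rewrite mulr_sumr -big_split /=.
      by apply: ler_sum => i _; exact: am.
    have h : 4 / al * (\sum_(i in A) g i) <= 4 / al * 8.
      by rewrite ler_wpM2l ?divr_ge0 ?ltW.
    have h2 : 4 / al * 8 <= m * al / 16.
      rewrite mulrAC ler_pdivrMr //.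
      have -> : m * al / 16 * al = m * al ^+ 2 / 16 by field.
      lra.
    lra.
  have markov : (1 - \sum_(z | F z <= (\sum_(i in A) al) / 2) prodf Q z) *
       (m * al / 2) <= m * al / 8.
    apply: le_trans Eup; rewrite -EF -[X in X - _](fdist_sum1 (prodf Q)).
    rewrite [X in X - _](bigID (fun z => F z <= (\sum_(i in A) al) / 2)) /=.
    rewrite addrAC subrr add0r mulr_suml big_mkcond /=; apply: ler_sum => z _.
    have F0 : 0 <= F z by apply: sumr_ge0 => i _; exact: ler0n.
    case: ifP => [h|_]; last by rewrite mulr_ge0 ?prod_ge0.
    rewrite ler_wpM2l ?prod_ge0 //; move: h; rewrite -ltNge sal => /ltW //.
  have mal0 : 0 < m * al by rewrite mulr_gt0.
  move: markov; set X := \sum_(z | _) _; nra.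
rewrite distrC; apply: le_trans (ler_norm _); lra.
Qed.

Lemma noise_nonscalar (R : realType) (n : nat) (nu : fdist R (bits n)) :
  (forall Q : 'I_n -> fdist R bool, exists E : pred (bits n),
    1 / 200 <= `|\sum_(z | E z) nu z - \sum_(z | E z) prodf Q z|) ->
  nonscalar (noise nu).
Proof.
move=> far s q; rewrite (@eq_avg _ _ _ (fun=> 1)) ?avg_const; first by lra.
move=> u; have [r gap] := noise_gap nu s q u.
by have [E hE] := far r; rewrite (le_trans hE (gap E)).
Qed.

Lemma card_ord_range (n a b : nat) : (a <= b)%N -> (b <= n)%N ->
  #|finset (fun k : 'I_n => (a <= k < b)%N)| = (b - a)%N.
Proof.
move=> ab bn; rewrite cardsE -sum1_card.
rewrite -(big_mkord (fun k => (a <= k < b)%N) (fun=> 1%N)).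
rewrite (@big_cat_nat _ _ _ a) //=; last exact: leq_trans bn.
rewrite big_nat_cond big1 ?add0n => [|k]; last by lia.
rewrite (@big_cat_nat _ _ _ b) //= [X in (_ + X)%N]big_nat_cond.
rewrite [X in (_ + X)%N]big1 ?addn0 => [|k]; last by lia.
rewrite (eq_bigl (fun k => (a <= k < b)%N && true)) => [|k]; last by rewrite andbT.
by rewrite -big_nat_cond sum_nat_const_nat muln1.
Qed.

Lemma lt_rev_ord (n : nat) (k : 'I_n) :
  (k < 2 * (n %/ 4))%N -> (k < rev_ord k)%N.
Proof.
have := leq_trunc_div n 4; rewrite mulnC => h /=; have := ltn_ord k.
by move: (n %/ 4)%N h => m; lia.
Qed.

Lemma card_ord_quarter (n : nat) :
  #|finset (fun k : 'I_n => (0 <= k < n %/ 4)%N)| = (n %/ 4)%N /\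
  #|finset (fun k : 'I_n => (n %/ 4 <= k < 2 * (n %/ 4))%N)| = (n %/ 4)%N.
Proof.
have := leq_trunc_div n 4; move: (n %/ 4)%N => m h.
by rewrite !card_ord_range; lia.
Qed.

(** On each pair one side uses the law [PN], which forbids (1,1), and the other the quotient [PM],
    whose transform restores that of i.i.d. noise of bias t. [PM] is nonnegative because t^2 <= a12
    <= a1^2, for which al = d / 4 leaves room. The roles are exchanged at index m, so each side has
    m pairs that betray it. *)
Lemma nonscalar_pairs (R : realType) (n : nat) (p q d : R) :
  0 < d -> d <= 1 / 2 -> (1 - 2 * p) * (1 - 2 * d) = 1 - 2 * q ->
  512 <= (n %/ 4)%:R * (d / 4) ^+ 2 ->
  exists K L : channel R (bits n) (bits n),
    [/\ forall xy, simulated (dsbs p) K L xy = iid (dsbs q) xy,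
        nonscalar K & nonscalar L].
Proof.
move=> d0 d1 tq big; set m := (n %/ 4)%N in big; set al := d / 4 in big *.
set t := 1 - 2 * d in tq *.
have al0 : 0 < al by rewrite /al; lra.
have al1 : al <= 1 / 8 by rewrite /al; lra.
have t0 : 0 <= t by rewrite /t; lra.
have t1 : t <= 1 by rewrite /t; lra.
pose a1 := 1 - 2 * al; pose a12 := 1 - 4 * al.
have a10 : 0 < a1 by rewrite /a1; lra.
have a120 : 0 < a12 by rewrite /a12; lra.
pose g1 := t / a1; pose g12 := t ^+ 2 / a12.
have g10 : 0 <= g1 by rewrite divr_ge0 // ltW.
have g120 : 0 <= g12 by rewrite divr_ge0 ?sqr_ge0 // ltW.
have g1a : a1 * g1 = t by rewrite /g1; field; rewrite gt_eqF.
have g12a : a12 * g12 = t ^+ 2 by rewrite /g12; field; rewrite gt_eqF.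
have tsq : t ^+ 2 <= a12.
  by rewrite /a12 /t /al; have := mulr_ge0 (ltW d0) (ltW d0); nra.
have g12_le : g12 <= 1 by rewrite /g12 ler_pdivrMr // mul1r.
have g12_ge : g1 ^+ 2 <= g12.
  rewrite /g1 /g12 expr_div_n ler_wpM2l ?sqr_ge0 //.
  rewrite lef_pV2 ?posrE ?exprn_gt0 //.
  by rewrite /a1 /a12; have := sqr_ge0 al; lra.
have [PN PNE] : exists P : fdist R (bool * bool)%type, forall b, P b = pair_pmf a1 a12 b.
  by apply: ex_pair_law; rewrite /a1 /a12; lra.
have [PM PME] : exists P : fdist R (bool * bool)%type, forall b, P b = pair_pmf g1 g12 b.
  apply: ex_pair_law; [lra|lra|].
  by have := sqr_ge0 (1 - g1); rewrite sqrrB; lra.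
(* [PI] (no noise) and [PT] (i.i.d. noise of bias t) serve the unpaired middle coordinate. *)
have [PI PIE] : exists P : fdist R (bool * bool)%type, forall b, P b = pair_pmf 1 1 b.
  by apply: ex_pair_law; lra.
have [PT PTE] : exists P : fdist R (bool * bool)%type,
    forall b, P b = pair_pmf t (t ^+ 2) b.
  apply: ex_pair_law.
  - by rewrite (_ : _ + _ = (1 + t) ^+ 2) ?sqr_ge0 //; ring.
  - by rewrite subr_ge0 expr_le1.
  - by rewrite (_ : _ + _ = (1 - t) ^+ 2) ?sqr_ge0 //; ring.
pose lt (k : 'I_n) := (k < rev_ord k)%N; pose X (k : 'I_n) := (k < m)%N.
pose r k := if lt k then (if X k then PN else PM) else PI.
pose r' k := if lt k then (if X k then PM else PN) else PT.
have rE k b : r k b = pair_pmf (if lt k then (if X k then a1 else g1) else 1)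
                               (if lt k then (if X k then a12 else g12) else 1) b.
  by rewrite /r; case: (lt k) (X k) => [] [].
have rE' k b : r' k b = pair_pmf (if lt k then (if X k then g1 else a1) else t)
                               (if lt k then (if X k then g12 else a12) else t ^+ 2) b.
  by rewrite /r'; case: (lt k) (X k) => [] [].
have lt_small (k : 'I_n) : (k < 2 * m)%N -> lt k by exact: lt_rev_ord.
have m2 k : (k < m)%N -> (k < 2 * m)%N by move=> km; rewrite mul2n -addnn ltn_addl.
have al1' : al <= 1 by lra.
exists (noise (pushf (prodf r) (@pairmap n))), (noise (pushf (prodf r') (@pairmap n))).
split.
- move=> xy; apply: (noise_exact _ tq) => S.
  rewrite (cf_pairmap _ rE) (cf_pairmap _ rE') -big_split /=.
  rewrite -prodr_const [RHS]big_mkcond /= [RHS]prod_rev_ord; apply: eq_bigr => k _.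
  rewrite -/(lt k); case: (lt k).
    rewrite /pair_cf; case: (X k) (k \in S) (rev_ord k \in S) => [] [] [];
      by rewrite ?mul1r ?mulr1 // ?g1a ?g12a ?[g1 * _]mulrC ?[g12 * _]mulrC ?g1a ?g12a.
  by case: (k == rev_ord k); rewrite /pair_cf ?mulr1 //; case: (k \in S); rewrite mul1r.
- apply: noise_nonscalar => Q.
  apply: (@pair_test R n r (finset (fun k : 'I_n => (0 <= k < m)%N)) al Q) => //.
  + by move=> i; rewrite inE => /andP[_ /m2]; exact: lt_small.
  + by move=> i b; rewrite inE => /andP[_ im]; rewrite rE lt_small ?m2 // /X im.
  + by rewrite (card_ord_quarter n).1.
- apply: noise_nonscalar => Q.
  apply: (@pair_test R n r' (finset (fun k : 'I_n => (m <= k < 2 * m)%N)) al Q) => //.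
  + by move=> i; rewrite inE => /andP[_ im]; apply: lt_small.
  + by move=> i b; rewrite inE => /andP[mi im]; rewrite rE' lt_small // /X ltnNge mi.
  + by rewrite (card_ord_quarter n).2.
Qed.

(** * A single uniform flip, for large epsilon *)

Lemma KL_le_chi2 (R : realType) (T : finType) (P Q : T -> R) :
  (forall x, 0 <= P x) -> (forall x, 0 < Q x) -> \sum_x P x = 1 ->
  (KL P Q <= (\sum_x P x ^+ 2 / Q x - 1)%:E)%E.
Proof.
move=> P0 Q0 P1; rewrite /KL ifT; last by apply/forallP => x; rewrite gt_eqF.
rewrite lee_fin -[X in _ - X]P1 -sumrB; apply: ler_sum => x _.
have -> : P x ^+ 2 / Q x - P x = P x * (P x / Q x - 1) by field; rewrite gt_eqF.
have [->|Pn0] := eqVneq (P x) 0; first by rewrite !mul0r.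
have Pgt : 0 < P x by rewrite lt_neqAle eq_sym Pn0 P0.
rewrite ler_wpM2l //.
have := expR_ge1Dx (ln (P x / Q x)); rewrite lnK ?posrE ?divr_gt0 //; lra.
Qed.

Definition empty_on (n : nat) (A : {set 'I_n}) (z : bits n) : bool :=
  [forall k in A, ~~ z k].

Lemma prodf_empty (R : realType) (n : nat) (Q : 'I_n -> fdist R bool) (A : {set 'I_n}) :
  \sum_(z | empty_on A z) prodf Q z = \prod_(k in A) Q k false.
Proof.
transitivity (\sum_z prodf Q z * \prod_k (if k \in A then (~~ z k)%:R else 1)).
  rewrite big_mkcond; apply: eq_bigr => z _; case: ifP => [/forallP h|/negbT].
    rewrite [X in _ * X]big1 ?mulr1 // => k _; case: ifP => // kA.
    by have := h k; rewrite kA /= => ->.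
  rewrite negb_forall => /existsP[k]; rewrite negb_imply negbK => /andP[kA zk].
  by rewrite [X in _ * X](bigD1 k) //= kA zk mul0r mulr0.
rewrite (prodf_expect Q (fun k b => if k \in A then (~~ b)%:R else 1)).
rewrite [RHS]big_mkcond /=; apply: eq_bigr => k _; case: ifP => _.
  by rewrite sum_bool /= mulr0 add0r mulr1.
by rewrite -[RHS](fdist_sum1 (Q k)); apply: eq_bigr => b _; rewrite mulr1.
Qed.

(* [nu] is empty on A (on B) with probability 1 - a, but never meets both;
   under a product law the two events are independent. *)
Lemma exclusion_test (R : realType) (n : nat) (nu : fdist R (bits n))
    (A B : {set 'I_n}) (a : R) (Q : 'I_n -> fdist R bool) :
  (forall k, k \in A -> k \notin B) -> 1 / 8 <= a -> a <= 1 ->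
  \sum_(z | empty_on A z) nu z = 1 - a ->
  \sum_(z | empty_on B z) nu z = 1 - a ->
  \sum_(z | empty_on (A :|: B)%SET z) nu z = 1 - 2 * a ->
  exists E : pred (bits n),
    1 / 200 <= `|\sum_(z | E z) nu z - \sum_(z | E z) prodf Q z|.
Proof.
move=> dAB a8 a1 nA nB nAB; apply: contrapT => none.
have close E : `|\sum_(z | E z) nu z - \sum_(z | E z) prodf Q z| < 1 / 200.
  by rewrite ltNge; apply/negP => h; apply: none; exists E.
have := close (empty_on A); have := close (empty_on B).
have := close (empty_on (A :|: B)%SET); rewrite nA nB nAB !prodf_empty.
have -> : \prod_(k in (A :|: B)%SET) Q k false =
    (\prod_(k in A) Q k false) * \prod_(k in B) Q k false.
  rewrite big_mkcond [X in _ = X * _]big_mkcond [X in _ = _ * X]big_mkcond.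
  rewrite -big_split; apply: eq_bigr => k _; rewrite finset.in_setU.
  have := dAB k; case: (k \in A) => [/(_ isT)/negbTE ->|_] /=; by rewrite ?mulr1 ?mul1r.
have Q01 k : 0 <= Q k false <= 1.
  rewrite fdist_ge0 -(fdist_sum1 (Q k)) (bigD1 false) //= lerDl.
  by apply: sumr_ge0 => c _; exact: fdist_ge0.
have pr01 (S : {set 'I_n}) : 0 <= \prod_(k in S) Q k false <= 1.
  apply/andP; split; first by apply: prodr_ge0 => k _; exact: fdist_ge0.
  by apply: prodr_ile1 => k _.
move: (pr01 A) (pr01 B).
move: (\prod_(k in A) _) (\prod_(k in B) _) => x y /andP[x0 x1] /andP[y0 y1].
rewrite !ltr_norml => /andP[h1 h2] /andP[h3 h4] /andP[h5 h6].
(* Independence under Q would put (1 - a)^2 within 3/200 of 1 - 2a, but they differ by a^2 >= 1/64,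
   which exceeds 3/200. *)
have : (1 - a - x) * (1 - a) + x * (1 - a - y) <= 2 * (1 / 200).
  have : (1 - a - x) * (1 - a) <= 1 / 200 * 1 by nra.
  have : x * (1 - a - y) <= 1 * (1 / 200) by nra.
  lra.
nra.
Qed.

Lemma unif_ge0 (R : realType) (n : nat) (i : 'I_n) : 0 <= n%:R^-1 :> R.
Proof. by rewrite invr_ge0. Qed.

Lemma unif_sum1 (R : realType) (n : nat) : (0 < n)%N -> \sum_(i < n) n%:R^-1 = 1 :> R.
Proof.
move=> n0; rewrite sumr_const card_ord -[LHS]mulr_natl divff //.
by rewrite pnatr_eq0 -lt0n.
Qed.

Definition unif (R : realType) (n : nat) (n0 : (0 < n)%N) : fdist R 'I_n :=
  Fdist (@unif_ge0 R n) (unif_sum1 R n0).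

Definition hit (n : nat) (H : {set 'I_n}) (J : 'I_n) : bits n :=
  [ffun k => (k == J) && (J \in H)].

(** The place J of the extra flip is uniform over all coordinates and the flip is dropped outside
    [H], so each coordinate of [H] is flipped with probability exactly 1/n, and never two of them
    together. *)
Definition flip_noise (R : realType) (n : nat) (n0 : (0 < n)%N) (H : {set 'I_n})
    (r : 'I_n -> fdist R bool) : fdist R (bits n) :=
  pushf (pairf (unif R n0) (prodf r)) (fun w => xorv (hit H w.1) w.2).

Lemma flip_noise_expect (R : realType) (n : nat) (n0 : (0 < n)%N) (H : {set 'I_n})
    (r : 'I_n -> fdist R bool) (phi : bits n -> R) :
  \sum_z flip_noise n0 H r z * phi z =
  n%:R^-1 * \sum_J \sum_b prodf r b * phi (xorv (hit H J) b).
Proof.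
rewrite /flip_noise push_expect.
transitivity (\sum_J \sum_b n%:R^-1 * prodf r b * phi (xorv (hit H J) b)).
  by rewrite pair_bigA.
rewrite mulr_sumr; apply: eq_bigr => J _; rewrite mulr_sumr.
by apply: eq_bigr => b _; rewrite mulrA.
Qed.

Lemma flip_noise_empty (R : realType) (n : nat) (n0 : (0 < n)%N) (H A : {set 'I_n})
    (r : 'I_n -> fdist R bool) :
  (forall k, k \in H -> r k true = 0) -> A \subset H ->
  \sum_(z | empty_on A z) flip_noise n0 H r z = 1 - #|A|%:R / n%:R.
Proof.
move=> rH /fintype.subsetP AH.
transitivity (\sum_z flip_noise n0 H r z * (empty_on A z)%:R).
  by rewrite big_mkcond; apply: eq_bigr => z _; case: ifP; rewrite ?mulr1 ?mulr0.
rewrite flip_noise_expect.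
have inner J : \sum_b prodf r b * (empty_on A (xorv (hit H J) b))%:R = (J \notin A)%:R.
  rewrite -[RHS]mul1r -(fdist_sum1 (prodf r)) mulr_suml; apply: eq_bigr => b _.
  have [[k kH bk]|nob] := pselect (exists2 k, k \in H & b k).
    by rewrite /= (bigD1 k) //= bk rH // !mul0r.
  have b0 k : k \in H -> b k = false.
    by move=> kH; apply/negP => bk; apply: nob; exists k.
  suff -> : empty_on A (xorv (hit H J) b) = (J \notin A) by [].
  rewrite /empty_on; apply/forallP/idP => [h|JA k].
    apply/negP => JA; have := h J.
    by rewrite JA !ffunE eqxx (AH _ JA) (b0 J (AH J JA)).
  apply/implyP => kA; rewrite !ffunE (b0 k (AH k kA)) addbF negb_and.
  by case: eqP => [e|//]; move: JA; rewrite -e kA.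
rewrite (eq_bigr _ (fun J _ => inner J)).
have -> : \sum_J (J \notin A)%:R = n%:R - #|A|%:R :> R.
  have -> : n%:R = \sum_(J < n) 1 :> R by rewrite sumr_const card_ord.
  have -> : #|A|%:R = \sum_(J in A) 1 :> R by rewrite sumr_const.
  rewrite [X in _ - X]big_mkcond -sumrB; apply: eq_bigr => J _.
  by case: (J \in A); rewrite ?subrr ?subr0.
by rewrite mulrBr mulVf ?pnatr_eq0 -?lt0n // mulrC.
Qed.

(** The second moment, under DSBS(q), of the likelihood ratio of a pair with one bit flipped. *)
Definition overlap (R : realType) (q : R) : R := q ^+ 2 / (1 - q) + (1 - q) ^+ 2 / q.

Lemma overlap_bounds (R : realType) (q : R) : 0 < q -> q <= 1 / 2 ->
  1 <= overlap q /\ overlap q <= 2 / q.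
Proof.
move=> q0 q1; have q2 : 0 < 1 - q by lra.
have -> : overlap q = (q * (1 - q))^-1 - 3.
  by rewrite /overlap; field; rewrite !gt_eqF.
have qq : 0 < q * (1 - q) by rewrite mulr_gt0.
split.
  have : 4 <= (q * (1 - q))^-1; last by lra.
  rewrite -[4]invrK lef_pV2 ?posrE ?invr_gt0 //.
  have := sqr_ge0 (q - 1 / 2); lra.
have : (q * (1 - q))^-1 <= 2 / q; last by lra.
rewrite ler_pdivlMr // invfM mulrAC mulVf ?gt_eqF // mul1r.
by rewrite -[2]invrK lef_pV2 ?posrE ?invr_gt0 //; lra.
Qed.

(** Expand the square into pairs of shifts a, b and factor over coordinates: a factor is 1 unless
    both shifts flip that coordinate. *)
Lemma mixture_chi2 (R : realType) (n : nat) (q : R) (T : finType) (w : T -> R)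
    (c : T -> bits n) : 0 < q -> q < 1 ->
  \sum_(xy : bits n * bits n)
     (\sum_a w a * iid (dsbs q) (xorv (c a) xy.1, xy.2)) ^+ 2 / iid (dsbs q) xy =
  \sum_a \sum_b w a * w b * \prod_i (if c a i && c b i then overlap q else 1).
Proof.
move=> q0 q1; have q2 : 0 < 1 - q by lra.
transitivity (\sum_(xy : bits n * bits n) \sum_a \sum_b w a * w b *
  \prod_i (dsbs q (c a i (+) xy.1 i, xy.2 i) * dsbs q (c b i (+) xy.1 i, xy.2 i)
           / dsbs q (xy.1 i, xy.2 i))).
  apply: eq_bigr => xy _; rewrite expr2 mulr_suml mulr_suml.
  apply: eq_bigr => a _; rewrite mulr_sumr mulr_suml; apply: eq_bigr => b _.
  rewrite big_split big_split /= prodfV /iid /=.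
  under [X in w a * X]eq_bigr do rewrite ffunE.
  under [X in _ * (w b * X)]eq_bigr do rewrite ffunE.
  by rewrite !mulrA; congr (_ * _ / _); ring.
rewrite exchange_big /=; apply: eq_bigr => a _.
rewrite exchange_big /=; apply: eq_bigr => b _.
rewrite -mulr_sumr; congr (_ * _).
transitivity (\sum_(x : bits n) \sum_(y : bits n)
  \prod_i (dsbs q (c a i (+) x i, y i) * dsbs q (c b i (+) x i, y i)
           / dsbs q (x i, y i))); first by rewrite pair_bigA.
rewrite (sum_ffun2_prod (fun i s t => dsbs q (c a i (+) s, t) *
   dsbs q (c b i (+) s, t) / dsbs q (s, t))).
apply: eq_bigr => i _; rewrite !sum_bool /dsbs /overlap.
by case: (c a i) (c b i) => [] [] /=; field; rewrite !gt_eqF.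
Qed.

Lemma cf_flip_noise (R : realType) (n : nat) (n0 : (0 < n)%N) (H : {set 'I_n})
    (r : 'I_n -> fdist R bool) (S : {set 'I_n}) :
  cf (flip_noise n0 H r) S =
  n%:R^-1 * (\sum_J chi R S (hit H J)) * cf (prodf r) S.
Proof.
rewrite /cf flip_noise_expect -mulrA; congr (_ * _); rewrite mulr_suml.
apply: eq_bigr => J _; rewrite mulr_sumr; apply: eq_bigr => b _.
by rewrite chi_xor; ring.
Qed.

(** The product noises alone give the exact target. The extra flips multiply its Fourier
    coefficients by characters, hence translate it; a flip of Y acts like the same flip of X, so
    both are moved to x. *)
Lemma simulated_flip_noise (R : realType) (n : nat) (n0 : (0 < n)%N)
    (H H' : {set 'I_n}) (r r' : 'I_n -> fdist R bool) (p q t : R) x y :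
  (1 - 2 * p) * t = 1 - 2 * q ->
  (forall S, cf (prodf r) S * cf (prodf r') S = t ^+ #|S|) ->
  simulated (dsbs p) (noise (flip_noise n0 H r)) (noise (flip_noise n0 H' r')) (x, y) =
  \sum_(a : 'I_n * 'I_n) pairf (unif R n0) (unif R n0) a *
    iid (dsbs q) (xorv (xorv (hit H a.1) (hit H' a.2)) x, y).
Proof.
move=> pt cfE; rewrite simulated_noise mulr_sumr.
transitivity (\sum_(S : {set 'I_n}) \sum_(a : 'I_n * 'I_n) (4 ^+ n)^-1 *
  ((n%:R^-1 * n%:R^-1) * ((1 - 2 * q) ^+ #|S| *
     (chi R S (hit H a.1) * chi R S (hit H' a.2)) * chi R S x * chi R S y))).
  apply: eq_bigr => S _; rewrite !cf_flip_noise -pt exprMn -cfE.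
  transitivity ((4 ^+ n)^-1 * (n%:R^-1 * n%:R^-1) * ((1 - 2 * p) ^+ #|S| *
    (cf (prodf r) S * cf (prodf r') S) * chi R S x * chi R S y) *
    ((\sum_J chi R S (hit H J)) * \sum_J chi R S (hit H' J))); first by ring.
  have -> : (\sum_J chi R S (hit H J)) * (\sum_J chi R S (hit H' J)) =
      \sum_(a : 'I_n * 'I_n) chi R S (hit H a.1) * chi R S (hit H' a.2).
    rewrite mulr_suml -(pair_bigA _ (fun J J' => chi R S (hit H J) * chi R S (hit H' J'))).
    by apply: eq_bigr => J _; rewrite mulr_sumr.
  by rewrite mulr_sumr; apply: eq_bigr => a _; rewrite cfE; ring.
rewrite exchange_big /=; apply: eq_bigr => a _.
rewrite iid_chi !mulr_sumr; apply: eq_bigr => S _.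
by rewrite !chi_xor; ring.
Qed.

(** On [H] only the first flip of a draw can act, off [H] only the second. Two draws thus overlap
    only where their first or their second flips coincide, at the cost of one factor [k] each. *)
Lemma overlap_prod_le (R : realType) (n : nat) (H : {set 'I_n}) (k : R)
    (a b : 'I_n * 'I_n) : 1 <= k ->
  \prod_i (if xorv (hit H a.1) (hit (~: H)%SET a.2) i &&
              xorv (hit H b.1) (hit (~: H)%SET b.2) i then k else 1) <=
  1 + k ^+ 2 * (a.1 == b.1)%:R + k ^+ 2 * (a.2 == b.2)%:R.
Proof.
move=> k1; have k0 : 0 <= k by apply: le_trans k1.
have single (j : 'I_n) (c : bool) :
    \prod_i (if (i == j) && c then k else 1) = if c then k else 1.
  rewrite (bigD1 j) //= eqxx big1 ?mulr1 // => i /negbTE ->; exact: erefl.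
apply: (@le_trans _ _ (\prod_i ((if (i == a.1) && (a.1 == b.1) then k else 1) *
   (if (i == a.2) && (a.2 == b.2) then k else 1)))).
  apply: ler_prod => i _; apply/andP; split; first by case: ifP.
  have one c : 1 <= (if c then k else 1) by case: c.
  case: ifP => [|_]; last by rewrite -[leLHS]mulr1 ler_pM.
  have hitE (G : {set 'I_n}) J : hit G J i = (i == J) && (i \in G).
    by rewrite ffunE; case: eqP => [->|].
  rewrite !(ffunE, hitE) !finset.in_setC.
  case: (i \in H); rewrite ?andbF ?andbT ?addbF ?addFb => /andP[/eqP e1 /eqP e2].
    by rewrite -e1 -e2 !eqxx ler_peMr.
  by rewrite -e1 -e2 !eqxx ler_peMl.
rewrite big_split /= !single.
have k2 : k <= k ^+ 2 by rewrite expr2 ler_peMl.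
by case: (a.1 == b.1) (a.2 == b.2) => [] [] /=; rewrite ?mulr1 ?mul1r ?mulr0 -?expr2; lra.
Qed.

Lemma quarter_bounds (R : realType) (n : nat) : (3 < n)%N ->
  1 / 8 <= (n %/ 4)%:R / n%:R :> R /\ (n %/ 4)%:R / n%:R <= 1 :> R.
Proof.
move=> n4; have n0 : 0 < n%:R :> R by rewrite ltr0n; lia.
have h1 : (n <= 8 * (n %/ 4))%N by lia.
have h2 : (n %/ 4 <= n)%N by lia.
split.
  rewrite ler_pdivlMr //.
  have : n%:R <= (8 * (n %/ 4))%:R :> R by rewrite ler_nat.
  rewrite natrM; lra.
by rewrite ler_pdivrMr // mul1r ler_nat.
Qed.

(** Two adjacent blocks of n/4 coordinates starting at [a], both inside [H]: the single flip meets
    either block but never both. *)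
Lemma flip_noise_nonscalar (R : realType) (n : nat) (n0 : (0 < n)%N)
    (H : {set 'I_n}) (r : 'I_n -> fdist R bool) (a : nat) :
  (3 < n)%N -> (a + 2 * (n %/ 4) <= n)%N ->
  (forall k, k \in H -> r k true = 0) ->
  (forall k : 'I_n, (a <= k < a + 2 * (n %/ 4))%N -> k \in H) ->
  nonscalar (noise (flip_noise n0 H r)).
Proof.
move=> n4 an rH sub; apply: noise_nonscalar => Q; set m := (n %/ 4)%N in an sub.
have [m8 m1] := quarter_bounds R n4.
pose rng s e : {set 'I_n} := finset (fun k : 'I_n => (s <= k < e)%N).
have rngU : (rng a (a + m) :|: rng (a + m) (a + 2 * m))%SET = rng a (a + 2 * m)%N.
  by apply/setP => k; rewrite finset.in_setU !inE; clear; lia.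
have rngH s e : (a <= s)%N -> (e <= a + 2 * m)%N -> rng s e \subset H.
  move=> h1 h2; apply/fintype.subsetP => k; rewrite inE => /andP[k1 k2].
  by apply: sub; rewrite (leq_trans h1 k1) (leq_trans k2 h2).
have am : (a + m <= a + 2 * m)%N by rewrite leq_add2l leq_pmull.
have pr s e : (a <= s)%N -> (s <= e)%N -> (e <= a + 2 * m)%N ->
    \sum_(z | empty_on (rng s e) z) flip_noise n0 H r z = 1 - (e - s)%:R / n%:R.
  move=> h1 h2 h3; rewrite flip_noise_empty ?rngH // card_ord_range //.
  exact: leq_trans an.
apply: (@exclusion_test R n _ (rng a (a + m)%N) (rng (a + m)%N (a + 2 * m)%N)
  (m%:R / n%:R)) => //.
- by move=> k; rewrite !inE => /andP[_ km]; rewrite leqNgt km.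
- by rewrite pr ?leq_addr // addKn.
- by rewrite pr ?leq_addr // mul2n -addnn addnA addKn.
- by rewrite rngU pr ?leq_addr // addKn natrM mulrA.
Qed.

Lemma iid_gt0 (R : realType) (n : nat) (q : R) (xy : bits n * bits n) :
  0 < q -> q < 1 -> 0 < iid (dsbs q) xy.
Proof.
move=> q0 q1; apply: prodr_gt0 => i _; rewrite /dsbs.
by case: ifP => _; lra.
Qed.

(** Two independent draws agree in a given component with probability 1/n, so the chi-square
    distance is at most 2 k^2 / n, and k <= 2 / q <= 2 / p. *)
Lemma simulated_flip_noise_KL (R : realType) (n : nat) (n0 : (0 < n)%N)
    (H : {set 'I_n}) (r r' : 'I_n -> fdist R bool) (p q t : R) :
  0 < p -> p <= q -> q <= 1 / 2 -> (1 - 2 * p) * t = 1 - 2 * q ->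
  (forall S, cf (prodf r) S * cf (prodf r') S = t ^+ #|S|) ->
  (KL (simulated (dsbs p) (noise (flip_noise n0 H r))
        (noise (flip_noise n0 (~: H)%SET r')))
      (iid (dsbs q) (n := n)) <= (8 / (p ^+ 2 * n%:R))%:E)%E.
Proof.
move=> p0 pq q2 pt cfE; have q0 : 0 < q by lra.
have q1 : q < 1 by lra.
have p1 : p <= 1 by lra.
have nR : 0 < n%:R :> R by rewrite ltr0n.
have [k1 k2] := overlap_bounds q0 q2.
apply: (le_trans (@KL_le_chi2 _ _ _ _ _ _ _)).
- by move=> xy; apply: simulated_ge0 => //; exact: ltW.
- by move=> xy; exact: iid_gt0.
- exact: simulated_sum1.
rewrite lee_fin.
pose w (a : 'I_n * 'I_n) : R := pairf (unif R n0) (unif R n0) a.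
pose c (a : 'I_n * 'I_n) := xorv (hit H a.1) (hit (~: H)%SET a.2).
rewrite (eq_bigr (fun xy => (\sum_a w a * iid (dsbs q) (xorv (c a) xy.1, xy.2)) ^+ 2
   / iid (dsbs q) xy)) => [|[x y] _]; last first.
  by rewrite (simulated_flip_noise n0 H _ x y pt cfE).
rewrite (mixture_chi2 w c q0 q1).
have w0 a : 0 <= w a by exact: fdist_ge0.
have w1 : \sum_a w a = 1 by exact: fdist_sum1.
set k := overlap q in k1 k2 *.
have marg (f : 'I_n -> R) : (\sum_J f J = 1) ->
    \sum_(b : 'I_n * 'I_n) w b * f b.1 = n%:R^-1 /\
    \sum_(b : 'I_n * 'I_n) w b * f b.2 = n%:R^-1.
  move=> f1; split.
    rewrite -(pair_bigA _ (fun i j => n%:R^-1 * n%:R^-1 * f i)) /=.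
    transitivity (\sum_i n%:R^-1 * f i); last by rewrite -mulr_sumr f1 mulr1.
    apply: eq_bigr => i _; rewrite sumr_const card_ord -[LHS]mulr_natl !mulrA.
    by rewrite divff ?mul1r // gt_eqF.
  rewrite -(pair_bigA _ (fun i j => n%:R^-1 * n%:R^-1 * f j)) /=.
  under eq_bigr do rewrite -mulr_sumr f1 mulr1.
  by rewrite sumr_const card_ord -[LHS]mulr_natl mulrA divff ?mul1r // gt_eqF.
have pt1 (J : 'I_n) : \sum_(I < n) (J == I)%:R = 1 :> R.
  by rewrite -[RHS](point_sum1 R J); apply: eq_bigr => I _; rewrite eq_sym.
have inner a : \sum_b w b * (1 + k ^+ 2 * (a.1 == b.1)%:R + k ^+ 2 * (a.2 == b.2)%:R)
    = 1 + 2 * k ^+ 2 / n%:R.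
  transitivity (\sum_b w b + k ^+ 2 * (\sum_b w b * (a.1 == b.1)%:R) +
     k ^+ 2 * (\sum_b w b * (a.2 == b.2)%:R)).
    by rewrite !mulr_sumr -!big_split /=; apply: eq_bigr => b _; ring.
  rewrite w1 (marg _ (pt1 a.1)).1 (marg _ (pt1 a.2)).2; ring.
have : \sum_a \sum_b w a * w b * \prod_i (if c a i && c b i then k else 1) <=
    1 + 2 * k ^+ 2 / n%:R.
  apply: (@le_trans _ _ (\sum_a w a * (1 + 2 * k ^+ 2 / n%:R))); last first.
    by rewrite -mulr_suml w1 mul1r.
  apply: ler_sum => a _; rewrite -(inner a) mulr_sumr; apply: ler_sum => b _.
  by rewrite -mulrA !ler_wpM2l // overlap_prod_le.
have kp : k <= 2 / p.
  by apply: (le_trans k2); rewrite ler_pM2l // lef_pV2 ?posrE.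
have : 2 * k ^+ 2 / n%:R <= 8 / (p ^+ 2 * n%:R).
  have -> : 8 / (p ^+ 2 * n%:R) = 2 * (2 / p) ^+ 2 / n%:R.
    by field; rewrite !gt_eqF.
  rewrite ler_pM2r ?invr_gt0 // ler_pM2l // ler_pXn2r ?nnegrE //.
    by rewrite (le_trans _ k1).
  by rewrite divr_ge0 // ltW.
lra.
Qed.

Lemma nonscalar_flip (R : realType) (n : nat) (p q t : R) :
  (3 < n)%N -> 0 < p -> p <= q -> q <= 1 / 2 -> `|t| <= 1 ->
  (1 - 2 * p) * t = 1 - 2 * q ->
  exists K L : channel R (bits n) (bits n),
    [/\ simulable (8 / (p ^+ 2 * n%:R)) (dsbs p) (dsbs q) K L,
        nonscalar K & nonscalar L].
Proof.
move=> n4 p0 pq q2 t1 pt; have n0 : (0 < n)%N by exact: ltn_trans n4.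
have n4m : (4 * (n %/ 4) <= n)%N by rewrite mulnC leq_trunc_div.
pose H : {set 'I_n} := finset (fun k : 'I_n => (k < 2 * (n %/ 4))%N).
have [r [r' [rH rH' _ cfE]]] := ex_split_noise H t1.
exists (noise (flip_noise n0 H r)), (noise (flip_noise n0 (~: H)%SET r')); split.
- exact: simulated_flip_noise_KL cfE.
- apply: (@flip_noise_nonscalar R n n0 H r 0) => //.
    by rewrite add0n; apply: leq_trans n4m; rewrite leq_mul2r orbT.
  by move=> k; rewrite add0n inE => /andP[].
- apply: (@flip_noise_nonscalar R n n0 _ r' (2 * (n %/ 4))%N) => //.
  + by rewrite -mulnDl.
  + by move=> k; rewrite finset.in_setC; exact: rH'.
  + by move=> k /andP[h _]; rewrite finset.in_setC inE -leqNgt.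
Qed.

(** * Passage to the limit *)

Lemma le_limn_einf (R : realType) (u : nat -> \bar R) (x : \bar R) :
  (\forall n \near \oo, (x <= u n)%E) -> (x <= limn_einf u)%E.
Proof.
move=> [N _ xu]; rewrite limn_einf_lim; apply: lime_ge; first exact: is_cvg_einfs.
exists N => // n /= Nn; apply: le_ereal_inf_tmp => _ [k /= nk <-].
by apply: xu; exact: leq_trans nk.
Qed.

Lemma nonscalar_bounded_away (R : realType) (p : R)
    (K : forall n, channel R (bits n) (bits n))
    (s : forall n, 'S_n) (q : forall n, 'I_n -> channel R bool bool)
    (pr : forall n, bits n * bits n -> bits n) :
  (forall n f, \sum_uv iid (dsbs p) uv * f (pr n uv) = avg f) ->
  (\forall n \near \oo, nonscalar (K n)) ->
  bounded_away_in_prob (dsbs p)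
    (fun n uv => scalar_gap (K n) (s n) (q n) (pr n uv)).
Proof.
move=> prE far; exists (1 / 200); first by rewrite divr_gt0.
apply: (@lt_le_trans _ _ (1 / 2)%:E); first by rewrite lte_fin divr_gt0.
apply: le_limn_einf; apply: filterS far => n far; rewrite lee_fin Pr_indicator.
rewrite (prE n (fun u => (1 / 200 <= scalar_gap (K n) (s n) (q n) u)%R%:R)).
exact: far.
Qed.

Lemma ex_exact (R : realType) (n : nat) (p q t : R) :
  `|t| <= 1 -> (1 - 2 * p) * t = 1 - 2 * q ->
  exists K L : channel R (bits n) (bits n),
    forall xy, simulated (dsbs p) K L xy = iid (dsbs q) xy.
Proof.
move=> t1 pt; have [r [r' [_ _ _ cfE]]] := ex_split_noise (@finset.set0 'I_n) t1.
by exists (noise (prodf r)), (noise (prodf r')) => xy; exact: (noise_exact _ pt).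
Qed.

Lemma exact_simulable (R : realType) (n : nat) (p q e : R)
    (K L : channel R (bits n) (bits n)) : 0 <= e ->
  (forall xy, simulated (dsbs p) K L xy = iid (dsbs q) xy) ->
  simulable e (dsbs p) (dsbs q) K L.
Proof. by move=> e0 simE; rewrite /simulable KL_eq0 ?lee_fin. Qed.

Lemma ex_nonscalar (R : realType) (n : nat) (p d e : R) :
  0 <= p -> 0 <= d -> p + d <= 1 / 2 -> 0 <= e ->
  exists K L : channel R (bits n) (bits n),
    simulable e (dsbs p) (dsbs (p + d)) K L /\
    (0 < d /\ 512 <= (n %/ 4)%:R * (d / 4) ^+ 2 \/
     (3 < n)%N /\ (0 < p -> 8 / (p ^+ 2 * n%:R) <= e) ->
     nonscalar K /\ nonscalar L).
Proof.
move=> p0 d0 q2 e0; set q := p + d in q2 *.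
(* If p = 1/2, division by zero makes t = 0; the equation still holds, since then q = 1/2. *)
pose t := (1 - 2 * q) / (1 - 2 * p).
have pt : (1 - 2 * p) * t = 1 - 2 * q.
  have [z|nz] := eqVneq (1 - 2 * p) 0; last by rewrite /t; field.
  by rewrite z mul0r; move: z q2; rewrite /q; lra.
have t1 : `|t| <= 1.
  rewrite ger0_norm; last by rewrite divr_ge0 //; rewrite /q in q2 *; lra.
  have [z|nz] := eqVneq (1 - 2 * p) 0; first by rewrite /t z invr0 mulr0.
  have pos : 0 < 1 - 2 * p by rewrite lt_neqAle eq_sym nz; rewrite /q in q2; lra.
  by rewrite /t ler_pdivrMr // /q; lra.
have [[dpos big]|ndelta] := pselect (0 < d /\ 512 <= (n %/ 4)%:R * (d / 4) ^+ 2).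
  have pos : 0 < 1 - 2 * p by rewrite /q in q2; lra.
  (* Noise of level d' takes correlation 1 - 2p to 1 - 2 (p + d). As d' >= d, the size condition
     carries over. *)
  pose d' := d / (1 - 2 * p).
  have dd' : d <= d' by rewrite /d' ler_pdivlMr // ler_piMr // ; lra.
  have [K [L [simE nK nL]]] : exists K L : channel R (bits n) (bits n),
    [/\ forall xy, simulated (dsbs p) K L xy = iid (dsbs q) xy,
        nonscalar K & nonscalar L].
    apply: (@nonscalar_pairs R n p q d'); first by rewrite divr_gt0.
    - by rewrite /d' ler_pdivrMr //; rewrite /q in q2; lra.
    - by rewrite /d' /q; field; rewrite gt_eqF.
    - apply: (le_trans big); rewrite ler_wpM2l // ler_pXn2r ?nnegrE //; lra.
  by exists K, L; split=> //; exact: exact_simulable.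
have [[n4 small]|neps] := pselect ((3 < n)%N /\ (0 < p -> 8 / (p ^+ 2 * n%:R) <= e)).
  have [p00|pn0] := eqVneq p 0.
    have pt0 : (1 - 2 * 0) * t = 1 - 2 * q by rewrite -p00.
    have [K [L [simE nK nL]]] := nonscalar_noiseless (ltnW n4) t1 pt0.
    exists K, L; split=> //; apply: exact_simulable => // xy.
    by rewrite p00; exact: simE.
  have pgt : 0 < p by rewrite lt_neqAle eq_sym pn0.
  have pq : p <= q by rewrite /q; lra.
  have [K [L [sim nK nL]]] := nonscalar_flip n4 pgt pq q2 t1 pt.
  exists K, L; split=> //; apply: (le_trans sim).
  by rewrite lee_fin; exact: small.
(* Simulability is demanded at every n, so outside both regimes a plain exact simulation is
   supplied. *)
have [K [L simE]] := ex_exact n t1 pt.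
by exists K, L; split; [exact: exact_simulable | case].
Qed.

Lemma little_omega_inv (R : realType) (a : R^nat) (c : R) :
  (forall n, 0 <= a n) -> 0 < c ->
  little_omega a (fun n => 1 / Num.sqrt n%:R) ->
  \forall n \near \oo, 1 / Num.sqrt n%:R <= c * a n.
Proof.
move=> a0 c0 /eqoP h; have := h c c0; apply: filterS => n hn.
rewrite -(ger0_norm (a0 n)); apply: le_trans hn; exact: ler_norm.
Qed.

Lemma scalar_impossibility (R : realType) (p : R) (delta epsilon : R^nat) :
  0 <= p ->
  (forall n, p <= p + delta n /\ p + delta n <= 1 / 2) ->
  (forall n, 0 <= epsilon n) ->
  little_omega delta (fun n => 1 / Num.sqrt n%:R) \/
  little_omega epsilon (fun n => 1 / Num.sqrt n%:R) ->
  exists K L : forall n, channel R (bits n) (bits n),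
    (forall n, simulable (epsilon n) (dsbs p) (dsbs (p + delta n))
                 (K n) (L n)) /\
    forall (s : forall n, 'S_n)
           (qX qY : forall n, 'I_n -> channel R bool bool),
      bounded_away_in_prob (dsbs p)
        (fun n uv => scalar_gap (K n) (s n) (qX n) uv.1) /\
      bounded_away_in_prob (dsbs p)
        (fun n uv => scalar_gap (L n) (s n) (qY n) uv.2).
Proof.
move=> p0 hdelta eps0 omega.
have d0 n : 0 <= delta n by have := (hdelta n).1; lra.
pose good n := 0 < delta n /\ 512 <= (n %/ 4)%:R * (delta n / 4) ^+ 2 \/
   (3 < n)%N /\ (0 < p -> 8 / (p ^+ 2 * n%:R) <= epsilon n).
have ex n : exists w : channel R (bits n) (bits n) * channel R (bits n) (bits n),
    simulable (epsilon n) (dsbs p) (dsbs (p + delta n)) w.1 w.2 /\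
    (good n -> nonscalar w.1 /\ nonscalar w.2).
  have [K [L h]] := ex_nonscalar n p0 (d0 n) (hdelta n).2 (eps0 n).
  by exists (K, L).
pose w n := sval (cid (ex n)); have wP n := svalP (cid (ex n)).
have sq (n : nat) : (1 / Num.sqrt n%:R) ^+ 2 = n%:R^-1 :> R.
  by rewrite div1r exprVn sqr_sqrtr.
have good_near : \forall n \near \oo, good n.
  case: omega => omega.
    (* This makes delta / 4 at least 64 / sqrt n; as n %/ 4 is at least n / 8, the product is at
       least 64^2 / 8 = 512. *)
    have c0 : 0 < (4 * 64)^-1 :> R by rewrite invr_gt0 mulr_gt0.
    near=> n; left.
    have n4 : (3 < n)%N by near: n; exact: nbhs_infty_gt.
    have nR : 0 < n%:R :> R by rewrite ltr0n; exact: leq_ltn_trans n4.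
    have h : 1 / Num.sqrt n%:R <= (4 * 64)^-1 * delta n.
      by near: n; exact: little_omega_inv.
    have x0 : 0 < 1 / Num.sqrt n%:R :> R by rewrite divr_gt0 // sqrtr_gt0.
    have dpos : 0 < delta n by rewrite -(pmulr_rgt0 _ c0); exact: lt_le_trans h.
    split=> //; have [m8 _] := quarter_bounds R n4.
    have h2 : 64 * (1 / Num.sqrt n%:R) <= delta n / 4.
      by rewrite mulrC ler_pdivlMr // -mulrA mulrC [64 * 4]mulrC -ler_pdivlMl ?mulr_gt0.
    have h3 : (64 * (1 / Num.sqrt n%:R)) ^+ 2 <= (delta n / 4) ^+ 2.
      by rewrite ler_pXn2r ?nnegrE // ?divr_ge0 // mulr_ge0 // ltW.
    apply: (@le_trans _ _ ((n %/ 4)%:R * (64 * (1 / Num.sqrt n%:R)) ^+ 2)).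
      rewrite exprMn sq mulrCA -[leLHS](_ : 64 ^+ 2 * (1 / 8) = _); last by field.
      by rewrite ler_wpM2l // exprn_ge0.
    by rewrite ler_wpM2l.
  have [pgt|ple] := ltrP 0 p; last first.
    near=> n; right; split; first by near: n; exact: nbhs_infty_gt.
    by rewrite ltNge ple.
  have c0 : 0 < p ^+ 2 / 8 by rewrite divr_gt0 // exprn_gt0.
  near=> n; right; split=> [|_]; first by near: n; exact: nbhs_infty_gt.
  have n0 : (0 < n)%N by near: n; exact: nbhs_infty_gt.
  have nR : 1 <= n%:R :> R by rewrite ler1n.
  have nR0 : 0 < n%:R :> R by rewrite ltr0n.
  have h : 1 / Num.sqrt n%:R <= p ^+ 2 / 8 * epsilon n.
    by near: n; exact: little_omega_inv.
  have x0 : 0 < 1 / Num.sqrt n%:R :> R by rewrite divr_gt0 // sqrtr_gt0.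
  have x1 : 1 / Num.sqrt n%:R <= 1 :> R.
    by rewrite -(@expr_le1 _ 2) ?(ltW x0) // sq invf_le1.
  (* 1/n is the square of 1 / sqrt n <= 1, so the O(1/n) divergence of the flip fits below
     epsilon. *)
  have h2 : n%:R^-1 <= p ^+ 2 / 8 * epsilon n.
    by apply: le_trans h; rewrite -sq [leLHS]expr2 ler_piMr // ltW.
  have -> : 8 / (p ^+ 2 * n%:R) = (p ^+ 2 / 8)^-1 * n%:R^-1.
    by field; rewrite !gt_eqF.
  by rewrite ler_pdivrMl.
exists (fun n => (w n).1), (fun n => (w n).2); split=> [n|s qX qY].
  by have [] := wP n.
split.
  apply: (@nonscalar_bounded_away R p (fun n => (w n).1) s qX (fun n uv => uv.1)).
    by move=> n f; exact: iid_expectl.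
  by apply: filterS good_near => n /(wP n).2[].
apply: (@nonscalar_bounded_away R p (fun n => (w n).2) s qY (fun n uv => uv.2)).
  by move=> n f; exact: iid_expectr.
by apply: filterS good_near => n /(wP n).2[].
Unshelve. all: by end_near. Qed.

(* The first part is stated for 0 < p < 1/2 only: it fails for p = 0 and for
   p = 1/2, where, with delta = epsilon = 0, any bijection of {0,1}^n applied
   to both inputs is an exact simulation. *)
Theorem theorem3 (R : realType) (p : R) (delta epsilon : R^nat)
    (hp : 0 <= p)
    (hdelta : forall n, p <= p + delta n /\ p + delta n <= 1 / 2)
    (hepsilon : forall n, 0 <= epsilon n) :
  (0 < p -> p < 1 / 2 ->
   little_o epsilon (fun n => 1 / n%:R) ->
   little_o delta (fun n => 1 / n%:R) ->
   forall K L : forall n, channel R (bits n) (bits n),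
     (forall n, simulable (epsilon n) (dsbs p) (dsbs (p + delta n))
                  (K n) (L n)) ->
     exists (s : forall n, 'S_n)
            (qX qY : forall n, 'I_n -> channel R bool bool),
       cvg0_in_prob (dsbs p)
         (fun n uv => scalar_gap (K n) (s n) (qX n) uv.1) /\
       cvg0_in_prob (dsbs p)
         (fun n uv => scalar_gap (L n) (s n) (qY n) uv.2))
  /\
  (little_omega delta (fun n => 1 / Num.sqrt n%:R) \/
   little_omega epsilon (fun n => 1 / Num.sqrt n%:R) ->
   exists K L : forall n, channel R (bits n) (bits n),
     (forall n, simulable (epsilon n) (dsbs p) (dsbs (p + delta n))
                  (K n) (L n)) /\
     forall (s : forall n, 'S_n)
            (qX qY : forall n, 'I_n -> channel R bool bool),
       bounded_away_in_prob (dsbs p)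
         (fun n uv => scalar_gap (K n) (s n) (qX n) uv.1) /\
       bounded_away_in_prob (dsbs p)
         (fun n uv => scalar_gap (L n) (s n) (qY n) uv.2)).
Proof.
split; last exact: scalar_impossibility.
by move=> p0 p2 oeps odelta K L; exact: scalar_recovery.
Qed.
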